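(* Let $n\ge 4$ and let $M$ be the set of (isomorphism classes of) connected multigraphs without loops on $n$ vertices containing exactly one cycle (the cycle may consist of only two vertices joined by two parallel edges). Let $\Gamma_1$ be the graph on 4 vertices consisting of a triangle together with one further edge joining a vertex of the triangle to the fourth vertex, and let $\Gamma_2$ be the 4-cycle. Then the families of spherical simplices generating the reflection group $D_n$ (families considered up to isometry) are in one-to-one correspondence with the graphs in $M\setminus\{\Gamma_1,\Gamma_2\}$. The correspondence is given as follows: realize the family by normal vectors $\pm f_1,\dots,\pm f_n$ which, suitably normalized, lie in $\Delta(D_n)=\{\pm h_i\pm h_j:1\le i<j\le n\}$ ($h_1,\dots,h_n$ the standard basis of $\mathbb{R}^n$); the associated graph has vertices $v_1,\dots,v_n$ corresponding to $h_1,\dots,h_n$, with an edge between $v_i$ and $v_j$ for each of $\pm(h_i+h_j)$, $\pm(h_i-h_j)$ occurring among the $f_k$ (so $v_i,v_j$ are joined by two edges if both occur).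
   Context: A family of spherical simplices in $S^{n-1}$ is the set of $2^n$ simplices cut out by $n$ hyperplanes through the origin in $\mathbb{R}^n$ with linearly independent unit normals $f_1,\dots,f_n$; it is encoded by $\pm f_1,\dots,\pm f_n$. The family generates the group generated by the reflections in the hyperplanes $f_i^\perp$; it generates $D_n$ if this group is the finite Coxeter (Weyl) group of type $D_n$ (up to conjugation by an orthogonal transformation). The graphs $\Gamma_1,\Gamma_2$ are excluded because their corresponding families coincide with those of the graphs on 4 vertices consisting of a double edge $ab$ plus the edges $ac,ad$, resp. a double edge $ab$ plus the edges $ac,bd$. *)

(* Defs.v *)
From HB Require Import structures.
From mathcomp Require Import all_boot all_order all_algebra.
From mathcomp Require Import perm reals.
Set Implicit Arguments. Unset Strict Implicit. Unset Printing Implicit Defensive.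
Import Order.TTheory GRing.Theory Num.Theory.
Local Open Scope ring_scope.

Section Defs.
Variables (R : realType) (n : nat).

Definition dotv (u v : 'rV[R]_n) : R := (u *m v^T) 0 0.

Definition hb (i : 'I_n) : 'rV[R]_n := delta_mx 0 i.

Definition orthogonal_mx (Q : 'M[R]_n) : Prop := Q^T *m Q = 1%:M.

(* matrix of the reflection in the hyperplane f^perp : x |-> x - 2 (x.f)/(f.f) f *)
Definition reflmx (f : 'rV[R]_n) : 'M[R]_n :=
  1%:M - (2 / dotv f f) *: (f^T *m f).

(* A family of spherical simplices, encoded by f_1..f_n: unit, linearly
   independent normals. The family itself is the set {+-f_i}. *)
Definition is_family (f : 'I_n -> 'rV[R]_n) : Prop :=
  (forall i, dotv (f i) (f i) = 1) /\ row_free (\matrix_(i < n) f i).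

Definition same_family (f g : 'I_n -> 'rV[R]_n) : Prop :=
  forall v, (exists i, v = f i \/ v = - f i) <-> (exists i, v = g i \/ v = - g i).

Definition isometric (f g : 'I_n -> 'rV[R]_n) : Prop :=
  exists Q, orthogonal_mx Q /\ same_family (fun i => f i *m Q) g.

(* the group generated by the reflections in the f_i^perp
   (finite products of these involutions) *)
Definition in_refl_group (f : 'I_n -> 'rV[R]_n) (M : 'M[R]_n) : Prop :=
  exists s : seq 'I_n, M = \big[mulmx/1%:M]_(i <- s) reflmx (f i).

Definition Dn_root (v : 'rV[R]_n) : Prop :=
  exists (i j : 'I_n) (s t : bool), (i < j)%N /\
    v = (-1) ^+ s *: hb i + (-1) ^+ t *: hb j.

Definition in_WD (M : 'M[R]_n) : Prop :=
  exists s : seq 'rV[R]_n, (forall v, v \in s -> Dn_root v) /\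
    M = \big[mulmx/1%:M]_(v <- s) reflmx v.

Definition generates_Dn (f : 'I_n -> 'rV[R]_n) : Prop :=
  exists Q, orthogonal_mx Q /\
    forall M, in_refl_group f M <-> in_WD (Q^T *m M *m Q).

Definition in_Delta (f : 'I_n -> 'rV[R]_n) : Prop :=
  forall k, Dn_root (Num.sqrt 2 *: f k).

(* a multigraph is a list of (unordered) edges; parallel edges allowed *)
Definition mgraph := seq ('I_n * 'I_n).

Definition upair (e : 'I_n * 'I_n) : 'I_n * 'I_n :=
  if (e.1 <= e.2)%N then e else (e.2, e.1).

Definition loopless (G : mgraph) : bool := all (fun e => e.1 != e.2) G.

Definition mg_iso (G G' : mgraph) : Prop :=
  exists p : {perm 'I_n},
    perm_eq [seq upair (p e.1, p e.2) | e <- G] [seq upair e | e <- G'].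

Definition mg_adj (G : mgraph) : rel 'I_n :=
  fun a b => has (fun e => (e == (a, b)) || (e == (b, a))) G.

Definition mg_connected (G : mgraph) : Prop :=
  forall i j : 'I_n, connect (mg_adj G) i j.

Definition edge_of (G : mgraph) (e : 'I_(size G)) : 'I_n * 'I_n :=
  tnth (in_tuple G) e.

Definition sdeg (G : mgraph) (C : {set 'I_(size G)}) (v : 'I_n) : nat :=
  #|[set e in C | (v == (edge_of e).1) || (v == (edge_of e).2)]|.

Definition edge_rel (G : mgraph) (C : {set 'I_(size G)}) : rel 'I_(size G) :=
  fun e e' => [&& e \in C, e' \in C &
     [|| (edge_of e).1 == (edge_of e').1, (edge_of e).1 == (edge_of e').2,
         (edge_of e).2 == (edge_of e').1 | (edge_of e).2 == (edge_of e').2]].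

(* a cycle = nonempty connected 2-regular sub-multigraph (edge set);
   two parallel edges form a cycle of length 2 *)
Definition is_cycle (G : mgraph) (C : {set 'I_(size G)}) : bool :=
  [&& C != set0,
      [forall v, (sdeg C v == 0%N) || (sdeg C v == 2%N)] &
      [forall e, forall e', ((e \in C) && (e' \in C)) ==> connect (edge_rel C) e e']].

Definition unicyclic (G : mgraph) : Prop :=
  #|[set C : {set 'I_(size G)} | is_cycle C]| = 1%N.

Definition in_M (G : mgraph) : Prop := [/\ loopless G, mg_connected G & unicyclic G].

Definition excluded (G : mgraph) : Prop :=
  n = 4%N /\ exists a b c d : 'I_n, uniq [:: a; b; c; d] /\
    (perm_eq [seq upair e | e <- G] [seq upair e | e <- [:: (a, b); (b, c); (a, c); (c, d)]]
     \/ perm_eq [seq upair e | e <- G] [seq upair e | e <- [:: (a, b); (b, c); (c, d); (d, a)]]).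

Definition plus_occ (f : 'I_n -> 'rV[R]_n) (i j : 'I_n) : bool :=
  [exists k, (Num.sqrt 2 *: f k == hb i + hb j) || (Num.sqrt 2 *: f k == - (hb i + hb j))].

Definition minus_occ (f : 'I_n -> 'rV[R]_n) (i j : 'I_n) : bool :=
  [exists k, (Num.sqrt 2 *: f k == hb i - hb j) || (Num.sqrt 2 *: f k == hb j - hb i)].

Definition all_pairs : seq ('I_n * 'I_n) :=
  [seq (i, j) | i <- enum 'I_n, j <- enum 'I_n].

Definition graph_of (f : 'I_n -> 'rV[R]_n) : mgraph :=
  filter (fun p : 'I_n * 'I_n => (nat_of_ord p.1 < nat_of_ord p.2)%N && plus_occ f p.1 p.2) all_pairs
  ++ filter (fun p : 'I_n * 'I_n => (nat_of_ord p.1 < nat_of_ord p.2)%N && minus_occ f p.1 p.2) all_pairs.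

End Defs.

(* Main.v *)
(* Over F_2 the even edge sets of a connected graph with n vertices form the kernel
   of an incidence matrix of rank n - 1, and the minimal nonempty ones are the
   cycles; so the graph is unicyclic iff it has n edges. With n edges the
   coboundaries (sign patterns removable by changing signs of coordinates) have
   index 2, and the vectors f_k are independent iff their sign pattern is not a
   coboundary. Any two independent families with the same graph therefore differ
   by coordinate signs. Independence and connectedness also give both roots
   h_i + h_j and h_i - h_j for some pair, hence all roots of D_n by reflecting along
   edges; conversely a disconnected graph gives a reducible group.
   The reflections of W(D_n) are those in its roots, so an isometry between two
   generating families preserves the root system. For n > 4 it is then a signed
   permutation. For n = 4 a non-excluded graph has a double edge, which leaves three
   graphs, told apart by the number of orthogonal pairs of normals; a family with an
   excluded graph is brought to one with a double edge by the reflection in a vector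
   (+-1/2, +-1/2, +-1/2, +-1/2). *)

Require Import Defs.
From HB Require Import structures.
From mathcomp Require Import all_boot all_order all_algebra.
From mathcomp Require Import perm reals boolp zify ring lra.
Set Implicit Arguments. Unset Strict Implicit. Unset Printing Implicit Defensive.
Import Order.TTheory GRing.Theory Num.Theory.
Local Open Scope ring_scope.

(** * Edge functions, connectivity and the incidence matrix over F_2 *)

(* Connectivity in cut form: a vertex 2-colouring constant along every edge is
   constant. *)
Definition econn (m n : nat) (e : 'I_m -> 'I_n * 'I_n) : Prop :=
  forall c : 'I_n -> bool,
    (forall k, c (e k).1 = c (e k).2) -> forall i j, c i = c j.

Lemma econn_eq (m n : nat) (e : 'I_m -> 'I_n * 'I_n) (T : eqType)
    (c : 'I_n -> T) :
  econn e -> (forall k, c (e k).1 = c (e k).2) -> forall i j, c i = c j.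
Proof.
move=> ce ck i j; apply/esym/eqP.
by rewrite -(ce (fun v => c v == c i) _ i j) // => k; rewrite ck.
Qed.

(** The connected component of a vertex is itself a 2-colouring constant along edges, and conversely
    such a colouring is closed under adjacency. *)
Lemma mg_connectedP (n : nat) (G : mgraph n) :
  mg_connected G <->
  (forall c : 'I_n -> bool, {in G, forall x, c x.1 = c x.2} ->
    forall i j, c i = c j).
Proof.
split=> [cG c cE i j|H i j].
  have cl : closed (mg_adj G) c.
    move=> x y /hasP[z zG /orP[]/eqP zE]; have := cE z zG;
    by rewrite zE /= -!topredE.
  by have := closed_connect cl (cG i j); rewrite -!topredE.
have E : mg_adj G =2 (fun a b => mg_adj G b a).
  by move=> a b; apply: eq_has => z; rewrite orbC.
rewrite -(H (connect (mg_adj G) i) _ i j) ?connect0 // => x xG.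
have adj : mg_adj G x.1 x.2.
  by apply/hasP; exists x => //; case: (x) => a b; rewrite eqxx.
apply/idP/idP => h; apply: connect_trans h (connect1 _) => //.
by rewrite E.
Qed.

Lemma mg_connected_edge (n : nat) (G : mgraph n) :
  mg_connected G <-> econn (@edge_of n G).
Proof.
rewrite mg_connectedP; split=> H c cE; apply: H.
  by move=> x /(nthP x)[i lti <-]; have := cE (Ordinal lti);
     rewrite /edge_of (tnth_nth x).
by move=> k; apply: cE; rewrite /edge_of mem_tnth.
Qed.

Lemma F2_cases (x : 'F_2) : x = 0 \/ x = 1.
Proof.
case: x => -[|[|x]] // h; [left|right]; exact: val_inj.
Qed.

Lemma natF2_eq0 (k : nat) : (k%:R == 0 :> 'F_2) = ~~ odd k.
Proof. by rewrite -(dvdn_pcharf (pchar_Fp (isT : prime 2))) dvdn2. Qed.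

Lemma natF2_bool (b c : bool) : b%:R + c%:R = (b (+) c)%:R :> 'F_2.
Proof. by case: b; case: c => //=; apply/val_inj. Qed.

Definition incmx (m n : nat) (e : 'I_m -> 'I_n * 'I_n) : 'M['F_2]_(m, n) :=
  \matrix_(k, v) (((e k).1 == v)%:R + ((e k).2 == v)%:R).

Lemma mul_incmx_tr (m n : nat) (e : 'I_m -> 'I_n * 'I_n) (d : 'rV['F_2]_n) k :
  (d *m (incmx e)^T) 0 k = d 0 (e k).1 + d 0 (e k).2.
Proof.
rewrite mxE; under eq_bigr => v _ do rewrite !mxE mulrDr.
rewrite big_split /=; congr (_ + _).
  rewrite (bigD1 (e k).1) //= eqxx mulr1 big1 ?addr0 // => v /negbTE.
  by rewrite eq_sym => ->; rewrite mulr0.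
rewrite (bigD1 (e k).2) //= eqxx mulr1 big1 ?addr0 // => v /negbTE.
by rewrite eq_sym => ->; rewrite mulr0.
Qed.

(** Over ['F_2] a vector killed by the transpose takes equal values at the two ends of every edge.
    Connectedness makes it constant, so this kernel is a line. *)
Lemma rank_incmx (m n : nat) (e : 'I_m -> 'I_n.+1 * 'I_n.+1) :
  econn e -> \rank (incmx e) = n.
Proof.
move=> ce.
have nz1 : const_mx 1 != 0 :> 'rV['F_2]_n.+1.
  by apply/eqP => /rowP /(_ 0); rewrite !mxE => /eqP; rewrite oner_eq0.
have rk : \rank (kermx (incmx e)^T) = 1%N.
  have -> : \rank (kermx (incmx e)^T) = \rank (const_mx 1 : 'rV['F_2]_n.+1).
    apply: eqmx_rank; apply/andP; split.
      apply/rV_subP => y /sub_kermxP yB.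
      have yE k : y 0 (e k).1 = y 0 (e k).2.
        have := congr1 (fun x : 'rV_m => x 0 k) yB.
        rewrite /= mul_incmx_tr mxE.
        by case: (F2_cases (y 0 (e k).1)) (F2_cases (y 0 (e k).2))
          => -> [] -> // /eqP.
      have yC := econn_eq ce yE.
      suff -> : y = y 0 0 *: const_mx 1 by exact: scalemx_sub.
      by apply/rowP => j; rewrite !mxE mulr1.
    apply/sub_kermxP/rowP => k; rewrite mul_incmx_tr !mxE.
    by apply/val_inj.
  by rewrite rank_rV nz1.
have := mxrank_ker (incmx e)^T; rewrite rk mxrank_tr.
have := rank_leq_col (incmx e); lia.
Qed.

(* For a family with edges e, take x k to say whether the two signs of f_k agree:
   x is a coboundary iff every cycle has an even number of edges h_i + h_j. *)
Definition coboundary (m n : nat) (e : 'I_m -> 'I_n * 'I_n)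
    (x : 'I_m -> bool) : Prop :=
  exists d : 'I_n -> bool, forall k, x k = d (e k).1 (+) d (e k).2.

Lemma coboundaryP (m n : nat) (e : 'I_m -> 'I_n * 'I_n) (x : 'I_m -> bool) :
  coboundary e x <->
  ((\row_k (x k)%:R : 'rV['F_2]_m) <= (incmx e)^T)%MS.
Proof.
split=> [[d dE]|/submxP[d dE]].
  apply/submxP; exists (\row_v (d v)%:R); apply/rowP => k.
  by rewrite mul_incmx_tr !mxE natF2_bool dE.
exists (fun v => d 0 v != 0) => k.
have := congr1 (fun z : 'rV_m => z 0 k) dE.
rewrite /= mul_incmx_tr mxE.
case: (F2_cases (d 0 (e k).1)) (F2_cases (d 0 (e k).2)) => -> [] ->;
  by case: (x k) => // /eqP.
Qed.

(** With as many edges as vertices the coboundaries form a hyperplane [B] of the edge space, and the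
    quotient has two elements. Writing [Y] modulo [B] as a multiple [c] of [X], the case [c = 0]
    would put [Y] in [B]; hence [c = 1] and the two nonzero classes cancel. *)
Lemma coboundary_addb (n : nat) (e : 'I_n.+1 -> 'I_n.+1 * 'I_n.+1)
    (x y : 'I_n.+1 -> bool) :
  econn e -> ~ coboundary e x -> ~ coboundary e y ->
  coboundary e (fun k => x k (+) y k).
Proof.
move=> ce; rewrite !coboundaryP => nx ny.
set B := (incmx e)^T in nx ny *.
have rB : \rank B = n by rewrite mxrank_tr rank_incmx.
set X : 'rV_n.+1 := \row_k _ in nx.
set Y : 'rV_n.+1 := \row_k _ in ny.
have full : row_full (B + X)%MS.
  rewrite /row_full eqn_leq rank_leq_col /=.
  have : (B < B + X)%MS.
    rewrite ltmxE addsmxSl /=; apply/negP => h; apply: nx.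
    exact: submx_trans (addsmxSr _ _) h.
  by move=> /rank_ltmx; rewrite rB.
have /sub_addsmxP[[u c] /= YE] := submx_full Y full.
have -> : \row_k (x k (+) y k)%:R = X + Y :> 'rV['F_2]_n.+1.
  by apply/rowP => k; rewrite !mxE natF2_bool.
case: (F2_cases (c 0 0)) => c0.
  case: ny; rewrite YE (mx11_scalar c) c0 mul_scalar_mx scale0r addr0.
  exact: submxMl.
rewrite YE (mx11_scalar c) c0 mul_scalar_mx scale1r addrC -addrA.
have -> : X + X = 0.
  by apply/rowP => k; rewrite !mxE natF2_bool addbb.
by rewrite addr0 submxMl.
Qed.

(** The coboundary space misses one dimension, so it omits the indicator of some single edge. *)
Lemma noncoboundary_exists (n : nat) (e : 'I_n.+1 -> 'I_n.+1 * 'I_n.+1) :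
  econn e -> exists x, ~ coboundary e x.
Proof.
move=> ce.
have : ~~ (1%:M <= (incmx e)^T)%MS.
  by rewrite sub1mx /row_full mxrank_tr rank_incmx // eqn_leq ltnn andbF.
move=> /row_subPn[i ni]; exists (fun k => k == i) => /coboundaryP h.
case/negP: ni; congr (is_true (_ <= _)%MS): h.
by apply/rowP => k; rewrite !mxE eq_sym.
Qed.

(** * Unicyclic connected graphs *)

(** These sets are the elements of the cycle space of [G] over the field with two elements. *)
Definition even_set (n : nat) (G : mgraph n) (C : {set 'I_(size G)}) : bool :=
  [forall v, ~~ odd (sdeg C v)].

Lemma sdeg_sum (n : nat) (G : mgraph n) (C : {set 'I_(size G)}) v :
  sdeg C v = (\sum_(k in C) ((v == (edge_of k).1) || (v == (edge_of k).2)))%N.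
Proof.
rewrite /sdeg -sum1_card big_mkcond /= [RHS]big_mkcond /=.
by apply: eq_bigr => k _; rewrite inE; case: (k \in C) => //=; case: (_ || _).
Qed.

Lemma edge_of_neq (n : nat) (G : mgraph n) k :
  loopless G -> (@edge_of n G k).1 != (edge_of k).2.
Proof. by move=> /allP /(_ (edge_of k)); apply; rewrite /edge_of mem_tnth. Qed.

Lemma even_setP (n : nat) (G : mgraph n) (C : {set 'I_(size G)}) :
  loopless G ->
  even_set C = ((\row_k (k \in C)%:R : 'rV['F_2]__) *m incmx (@edge_of n G) == 0).
Proof.
move=> lG.
have E v : ((\row_k (k \in C)%:R : 'rV['F_2]__) *m incmx (@edge_of n G)) 0 v
    = (sdeg C v)%:R.
  rewrite mxE sdeg_sum natr_sum [RHS]big_mkcond /=.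
  apply: eq_bigr => k _; rewrite !mxE.
  case: (k \in C); last by rewrite mul0r.
  (* Without loops an edge meets [v] at one end at most, so the exclusive or of the matrix entry
     agrees with the inclusive or counted by [sdeg]. *)
  rewrite mul1r natF2_bool ![v == _]eq_sym.
  move: (edge_of_neq k lG); case: (eqVneq (edge_of k).1 v) => [->|_ _] //.
  by rewrite eq_sym => /negbTE ->.
apply/forallP/eqP => [ev|C0 v].
  by apply/rowP => v; rewrite E mxE; apply/eqP; rewrite natF2_eq0.
by rewrite -natF2_eq0 -E C0 mxE.
Qed.

Lemma even_set_sym (n : nat) (G : mgraph n) (C D : {set 'I_(size G)}) :
  loopless G -> even_set C -> even_set D ->
  even_set [set k | (k \in C) (+) (k \in D)].
Proof.
move=> lG; rewrite !(even_setP _ lG) => /eqP C0 /eqP D0; apply/eqP.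
rewrite -[RHS](addr0 0) -{1}C0 -D0 -mulmxDl; congr (_ *m _).
by apply/rowP => k; rewrite !mxE inE natF2_bool.
Qed.

Lemma sdegS (n : nat) (G : mgraph n) (C D : {set 'I_(size G)}) v :
  C \subset D -> (sdeg C v <= sdeg D v)%N.
Proof.
move=> /subsetP CD; apply: subset_leq_card; apply/subsetP => k.
by rewrite !inE => /andP[/CD -> ->].
Qed.

Lemma handshake (n : nat) (G : mgraph n) (C : {set 'I_(size G)}) :
  loopless G -> (\sum_v sdeg C v = #|C|.*2)%N.
Proof.
move=> lG; under eq_bigr => v _ do rewrite sdeg_sum.
rewrite exchange_big /= -muln2 -sum_nat_const; apply: eq_bigr => k _.
have ne := edge_of_neq k lG.
rewrite (bigD1 (edge_of k).1) //= eqxx /= (bigD1 (edge_of k).2) 1?eq_sym //=.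
rewrite eqxx orbT big1 // => v /andP[/negbTE -> /negbTE ->] //.
Qed.

Lemma sdeg_symdiff (n : nat) (G : mgraph n) (C D : {set 'I_(size G)}) v :
  odd (sdeg [set k | (k \in C) (+) (k \in D)] v) =
  odd (sdeg C v) (+) odd (sdeg D v).
Proof.
rewrite !sdeg_sum !(big_mkcond (fun k => k \in _)) /= -oddD -big_split /=.
rewrite !(big_morph odd oddD (erefl : odd 0 = false)); apply: eq_bigr => k _.
by rewrite inE; case: (k \in C); case: (k \in D); rewrite ?addnn ?odd_double ?addn0.
Qed.

(** * Minimal nonempty even edge sets are cycles *)

Section MinimalEvenSet.
Variables (n : nat) (G : mgraph n) (C : {set 'I_(size G)}).
Hypotheses (lG : loopless G)
  (minC : minset (fun D : {set 'I_(size G)} => (D != set0) && even_set D) C).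

Let support := [set v | sdeg C v != 0%N].

Let C_nonempty : C != set0. Proof. by case/andP: (minsetp minC). Qed.
Let C_even : even_set C. Proof. by case/andP: (minsetp minC). Qed.
Let C_min (D : {set 'I_(size G)}) : D \subset C -> even_set D -> D != set0 -> D = C.
Proof. by move=> DC eD D0; case/minsetP: minC => _; apply; rewrite ?D0. Qed.

(* The subsets of C minus one edge are separated by their odd-degree vertices in
   the support of C minus one vertex. *)
Lemma minimal_even_card : (#|C| <= #|support|)%N.
Proof.
have [k0 k0C] := set0Pn _ C_nonempty.
pose v0 := (edge_of k0).1.
have v0S : v0 \in support.
  rewrite inE -lt0n; apply/card_gt0P; exists k0.
  by rewrite inE k0C /= eqxx.
pose F (X : {set 'I_(size G)}) := [set v in support :\ v0 | odd (sdeg X v)].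
have injF : {in powerset (C :\ k0) &, injective F}.
  move=> X Y; rewrite !powersetE => XC YC FE.
  pose Z := [set k | (k \in X) (+) (k \in Y)].
  have ZC : Z \subset C :\ k0.
    apply/subsetP => k; rewrite inE; case kX: (k \in X) => /=; [move=> _|move=> kY].
      exact: (subsetP XC).
    exact: (subsetP YC).
  have ZC' : Z \subset C by apply: subset_trans ZC (subsetDl _ _).
  have Zv v : v != v0 -> ~~ odd (sdeg Z v).
    move=> vv0; case vS: (v \in support).
      have := congr1 (fun A : {set 'I_n} => v \in A) FE.
      by rewrite /F !inE vv0; move: vS; rewrite inE => -> /= E;
         rewrite sdeg_symdiff E addbb.
    move: vS; rewrite inE => /negbFE /eqP vS.
    by have := sdegS v ZC'; rewrite vS leqn0 => /eqP ->.
  (* Only the parity at [v0] remains open, and the handshake identity settles it. *)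
  have Zev : even_set Z.
    apply/forallP => v; case: (eqVneq v v0) => [->|/Zv//].
    have := congr1 odd (handshake Z lG).
    rewrite odd_double (bigD1 v0) //= oddD.
    rewrite (big_morph odd oddD (erefl : odd 0 = false)) big1 ?addbF.
      by move=> ->.
    by move=> u /Zv /negbTE.
  have Z0 : Z = set0.
    apply/eqP; apply/negPn/negP => Zn; have ZE := C_min ZC' Zev Zn.
    by move: ZC; rewrite ZE => /subsetP /(_ k0 k0C); rewrite !inE eqxx.
  apply/setP => k; have := congr1 (fun A : {set _} => k \in A) Z0.
  by rewrite !inE; case: (k \in X); case: (k \in Y).
have := card_in_imset injF; rewrite card_powerset.
have sub : [set F X | X in powerset (C :\ k0)] \subset powerset (support :\ v0).
  apply/subsetP => _ /imsetP[X _ ->]; rewrite powersetE.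
  by apply/subsetP => v; rewrite inE => /andP[].
have := subset_leq_card sub => /[swap] ->; rewrite card_powerset leq_exp2l //.
by rewrite (cardsD1 k0 C) (cardsD1 v0 support) k0C v0S !add1n ltnS.
Qed.

(* The degrees on the support are even and nonzero, hence at least 2, and by the
   handshake identity their average is at most 2. *)
Lemma minimal_even_deg v : (sdeg C v == 0%N) || (sdeg C v == 2%N).
Proof.
have ge2 u : u \in support -> (2 <= sdeg C u)%N.
  rewrite inE; have /forallP/(_ u) := C_even.
  by case: (sdeg C u) => [|[|k]].
have sum0 : (\sum_(u in support) (sdeg C u - 2) = 0)%N.
  rewrite sumnB // sum_nat_const muln2; apply/eqP; rewrite subn_eq0.
  apply: leq_trans (_ : #|C|.*2 <= _)%N; last first.
    by rewrite leq_double minimal_even_card.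
  rewrite -handshake // [X in (_ <= X)%N](bigID (mem support)) /= leq_addr //.
case vS: (v \in support); last by move: vS; rewrite inE => /negbFE ->.
move/eqP: sum0; rewrite sum_nat_eq0 => /forallP/(_ v); rewrite vS /= subn_eq0.
by move=> le2; rewrite (eqn_leq _ 2) le2 ge2 ?orbT.
Qed.

(** All edges of [C] at a common vertex lie in one component, so a component [K] has at each vertex
    either the degree of [C] or degree 0. It is therefore even, and minimality gives [K = C]. *)
Lemma minimal_even_cycle : is_cycle C.
Proof.
apply/and3P; split=> //; first by apply/forallP => v; apply: minimal_even_deg.
apply/forallP => k; apply/forallP => l; apply/implyP => /andP[kC lC].
pose K := [set j in C | connect (edge_rel C) k j].
suff KC : K = C by have : l \in K by [rewrite KC]; rewrite inE => /andP[].
apply: C_min; first by apply/subsetP => j; rewrite inE => /andP[].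
  apply/forallP => v.
  case: (pickP (fun j => (j \in K) &&
      ((v == (edge_of j).1) || (v == (edge_of j).2)))) => [j /andP[jK vj]|none].
    suff -> : sdeg K v = sdeg C v by have /forallP := C_even.
    rewrite /sdeg; apply: eq_card => i; rewrite !inE.
    case iC: (i \in C) => //=.
    case vi: (_ || _); rewrite ?andbF // andbT.
    move: jK; rewrite inE => /andP[jC kj]; apply: connect_trans kj (connect1 _).
    rewrite /edge_rel jC iC /=.
    by case/orP: vj => /eqP <-; case/orP: vi => /eqP <-; rewrite eqxx ?orbT.
  suff -> : sdeg K v = 0%N by [].
  by apply: eq_card0 => j; rewrite inE; apply: none.
by apply/set0Pn; exists k; rewrite inE kC connect0.
Qed.

End MinimalEvenSet.

Lemma cycle_even (n : nat) (G : mgraph n) (C : {set 'I_(size G)}) :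
  is_cycle C -> even_set C.
Proof.
case/and3P=> _ /forallP deg _; apply/forallP => v.
by case/orP: (deg v) => /eqP ->.
Qed.

Lemma even_contains_cycle (n : nat) (G : mgraph n) (D : {set 'I_(size G)}) :
  loopless G -> D != set0 -> even_set D ->
  exists2 C : {set 'I_(size G)}, is_cycle C & C \subset D.
Proof.
move=> lG D0 eD.
pose P := fun D : {set 'I_(size G)} => (D != set0) && even_set D.
have PD : P D by rewrite /P D0.
have [C minC CD] := minset_exists (P := P) PD.
by exists C => //; apply: minimal_even_cycle minC.
Qed.

(** The cycle space has dimension [size G - (n - 1)], and the graph is unicyclic exactly when this
    dimension is 1. *)
Lemma unicyclic_size (n : nat) (G : mgraph n) :
  (0 < n)%N -> loopless G -> mg_connected G ->
  unicyclic G <-> size G = n.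
Proof.
case: n G => // n G _ lG /mg_connected_edge cG.
pose chi (C : {set 'I_(size G)}) : 'rV['F_2]_(size G) := \row_k (k \in C)%:R.
pose supp (x : 'rV['F_2]_(size G)) := [set k | x 0 k != 0].
have suppK x : chi (supp x) = x.
  apply/rowP => k; rewrite mxE inE.
  by case: (F2_cases (x 0 k)) => ->; rewrite ?eqxx ?oner_neq0.
have chi0 C : (chi C == 0) = (C == set0).
  apply/eqP/eqP => [/rowP C0|->]; last by apply/rowP => k; rewrite !mxE inE.
  apply/setP => k; have := C0 k; rewrite !mxE inE.
  by case: (k \in C) => // /eqP; rewrite oner_eq0.
have evP C : even_set C = (chi C <= kermx (incmx (@edge_of _ G)))%MS.
  by rewrite even_setP //; apply/eqP/sub_kermxP.
have rk := mxrank_ker (incmx (@edge_of _ G)); rewrite (rank_incmx cG) in rk.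
set K := kermx _ in evP rk.
have ltG : (n <= size G)%N by have := rank_leq_row (incmx (@edge_of _ G));
  rewrite rank_incmx.
split=> [/eqP/cards1P[C0 C0E]|szG].
  have cyc C : is_cycle C -> C = C0.
    by move=> cC; apply/set1P; rewrite -C0E inE.
  have cC0 : is_cycle C0 by have := set11 C0; rewrite -C0E inE.
  (* If [C] differs from [C0], both [C] and its symmetric difference with [C0] contain a cycle,
     necessarily [C0]. But an edge of [C0] lying in [C] is absent from that difference. *)
  have evC0 C : C != set0 -> even_set C -> C = C0.
    move=> Cn eC; apply/eqP; apply/negPn/negP => CC0.
    have [D cD DC] := even_contains_cycle lG Cn eC.
    rewrite (cyc _ cD) in DC.
    pose E := [set k | (k \in C) (+) (k \in C0)].
    have eE : even_set E by apply: even_set_sym => //; apply: cycle_even.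
    have En : E != set0.
      apply: contra_neq CC0 => E0; apply/setP => k.
      have := congr1 (fun A : {set _} => k \in A) E0.
      by rewrite !inE; case: (k \in C); case: (k \in C0).
    have [D' cD' DE] := even_contains_cycle lG En eE.
    rewrite (cyc _ cD') in DE.
    have /and3P[/set0Pn[k kC0] _ _] := cC0.
    have := subsetP DE k kC0; rewrite inE kC0.
    by rewrite (subsetP DC k kC0).
  have KC0 : (K <= chi C0)%MS.
    apply/rV_subP => x xK; have [->|x0] := eqVneq x 0; first exact: sub0mx.
    rewrite -(suppK x) (evC0 (supp x)) //; first by rewrite -chi0 suppK.
    by rewrite evP suppK.
  have : (chi C0 <= K)%MS by rewrite -evP cycle_even.
  have nC0 : chi C0 != 0 by rewrite chi0; case/and3P: cC0.
  move=> /mxrankS; have := mxrankS KC0; rewrite rank_rV nC0 rk /=; lia.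
(* The cycle space is now a line over ['F_2]; its only nonzero vector [x] is the indicator of the
   only nonempty even set, which must then be the cycle it contains. *)
have rk1 : \rank K = 1%N by rewrite rk szG subSnn.
have /rowV0Pn[x xK x0] : K != 0 by rewrite -mxrank_eq0 rk1.
have Kx : (K <= x)%MS.
  have := mxrank_leqif_sup xK; rewrite rank_rV x0 rk1 => /leqifP.
  by case: ifP.
have uniq C : C != set0 -> even_set C -> C = supp x.
  move=> Cn; rewrite evP => CK.
  have /sub_rVP[a aE] := submx_trans CK Kx.
  have := chi0 C; rewrite (negbTE Cn) aE => /negbT.
  case: (F2_cases a) aE => ->; first by rewrite scale0r eqxx.
  rewrite scale1r => <- _; apply/setP => k; rewrite inE mxE.
  by case: (k \in C); rewrite ?eqxx ?oner_neq0.
apply/eqP/cards1P; exists (supp x).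
have [C cC Cx] : exists2 C : {set 'I_(size G)}, is_cycle C & C \subset supp x.
  by apply: even_contains_cycle; rewrite -?chi0 ?evP ?suppK.
apply/setP => D; rewrite !inE; apply/idP/eqP => [cD|->].
  by apply: uniq; [case/and3P: cD | apply: cycle_even].
by rewrite -(uniq C) ?cycle_even //; case/and3P: cC.
Qed.

(** * Reflections and the roots of D_n *)

Section Vectors.
Variables (R : realType) (n : nat).
Implicit Types (u v w f : 'rV[R]_n) (Q M : 'M[R]_n) (i j k : 'I_n) (s t : bool).

Lemma hbE i k : hb R i 0 k = (k == i)%:R.
Proof. by rewrite mxE eqxx. Qed.

Lemma dotvE u v : dotv u v = \sum_i u 0 i * v 0 i.
Proof. by rewrite /dotv mxE; under eq_bigr do rewrite mxE. Qed.

Lemma dotvC u v : dotv u v = dotv v u.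
Proof. by rewrite !dotvE; under eq_bigr do rewrite mulrC. Qed.

Lemma dotvDl u v w : dotv (u + v) w = dotv u w + dotv v w.
Proof. by rewrite /dotv mulmxDl mxE. Qed.

Lemma dotvZl a u v : dotv (a *: u) v = a * dotv u v.
Proof. by rewrite /dotv -scalemxAl mxE. Qed.

Lemma dotvNl u v : dotv (- u) v = - dotv u v.
Proof. by rewrite -scaleN1r dotvZl mulN1r. Qed.

Lemma dotvDr u v w : dotv w (u + v) = dotv w u + dotv w v.
Proof. by rewrite !(dotvC w) dotvDl. Qed.

Lemma dotvZr a u v : dotv u (a *: v) = a * dotv u v.
Proof. by rewrite !(dotvC u) dotvZl. Qed.

Lemma dotvNr u v : dotv u (- v) = - dotv u v.
Proof. by rewrite !(dotvC u) dotvNl. Qed.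

Lemma dotv0l u : dotv 0 u = 0.
Proof. by rewrite /dotv mul0mx mxE. Qed.

Lemma dotv_hb v i : dotv v (hb R i) = v 0 i.
Proof.
rewrite dotvE (bigD1 i) //= hbE eqxx mulr1 big1 ?addr0 // => k /negbTE ki.
by rewrite hbE ki mulr0.
Qed.

Lemma dotv_eq0 v : (dotv v v == 0) = (v == 0).
Proof.
apply/eqP/eqP => [|->]; last by rewrite dotv0l.
rewrite dotvE => /eqP; rewrite psumr_eq0 => [/allP v0|i _]; last first.
  by rewrite -expr2 sqr_ge0.
apply/rowP => i; rewrite mxE; apply/eqP.
by have := v0 i (mem_index_enum _); rewrite mulf_eq0 orbb.
Qed.

Lemma dotv_orthogonal Q u v :
  orthogonal_mx Q -> dotv (u *m Q) (v *m Q) = dotv u v.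
Proof.
move=> /mulmx1C oQ.
by rewrite /dotv trmx_mul mulmxA -(mulmxA u) oQ mulmx1.
Qed.

Lemma orthogonal_tr Q : orthogonal_mx Q -> orthogonal_mx Q^T.
Proof. by move=> /mulmx1C oQ; rewrite /orthogonal_mx trmxK. Qed.

Lemma orthogonal_mul Q Q' :
  orthogonal_mx Q -> orthogonal_mx Q' -> orthogonal_mx (Q *m Q').
Proof.
rewrite /orthogonal_mx => oQ oQ'.
by rewrite trmx_mul mulmxA -(mulmxA _ _ Q) oQ mulmx1.
Qed.

Lemma orthogonal1 : orthogonal_mx (1%:M : 'M[R]_n).
Proof. by rewrite /orthogonal_mx trmx1 mulmx1. Qed.

Lemma mulmx_reflmx u f :
  u *m reflmx f = u - (2 / dotv f f * dotv u f) *: f.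
Proof.
rewrite mulmxBr mulmx1 -scalemxAr mulmxA; congr (_ - _).
by rewrite [u *m f^T]mx11_scalar mul_scalar_mx scalerA.
Qed.

Lemma reflmxZ a f : a != 0 -> reflmx (a *: f) = reflmx f.
Proof.
move=> a0; rewrite /reflmx dotvZl dotvZr.
have -> : (a *: f)^T = a *: f^T by apply: linearZ.
rewrite -scalemxAl -scalemxAr.
rewrite !scalerA; congr (_ - _ *: _).
have [->|f0] := eqVneq (dotv f f) 0; first by rewrite !mulr0 invr0; ring.
by field; rewrite a0 f0.
Qed.

Lemma reflmxN f : reflmx (- f) = reflmx f.
Proof. by rewrite -scaleN1r reflmxZ // oppr_eq0 oner_eq0. Qed.

Lemma reflmx_conj Q f :
  orthogonal_mx Q -> Q^T *m reflmx f *m Q = reflmx (f *m Q).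
Proof.
move=> oQ; rewrite /reflmx dotv_orthogonal // mulmxBr mulmxBl mulmx1 oQ.
by congr (_ - _); rewrite -scalemxAr -scalemxAl trmx_mul !mulmxA.
Qed.

Lemma reflmx_tr f : (reflmx f)^T = reflmx f.
Proof. by rewrite /reflmx linearB linearZ /= trmx_mul trmxK trmx1. Qed.

Lemma reflmx_orthogonal f : f != 0 -> orthogonal_mx (reflmx f).
Proof.
rewrite -dotv_eq0 => f0; rewrite /orthogonal_mx reflmx_tr.
apply/row_matrixP => i; rewrite !rowE mulmxA !mulmx_reflmx mulmx1.
rewrite dotvDl dotvNl dotvZl -addrA -opprD -scalerDl.
set a := dotv (delta_mx _ _) f; set b := dotv f f in f0 *.
suff -> : 2 / b * a + 2 / b * (a - 2 / b * a * b) = 0.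
  by rewrite scale0r subr0.
by field.
Qed.

Definition rootv i j s t : 'rV[R]_n := (-1) ^+ s *: hb R i + (-1) ^+ t *: hb R j.

Lemma rootvE i j s t k :
  rootv i j s t 0 k = (-1) ^+ s * (k == i)%:R + (-1) ^+ t * (k == j)%:R.
Proof. by rewrite mxE [X in X + _]mxE [X in _ + X]mxE !hbE. Qed.

Lemma rootvC i j s t : rootv i j s t = rootv j i t s.
Proof. exact: addrC. Qed.

Lemma rootvN i j s t : - rootv i j s t = rootv i j (~~ s) (~~ t).
Proof. by rewrite /rootv opprD -!scaleNr !signrN. Qed.

Lemma dotv_rootv v i j s t :
  dotv v (rootv i j s t) = (-1) ^+ s * v 0 i + (-1) ^+ t * v 0 j.
Proof. by rewrite dotvDr !dotvZr !dotv_hb. Qed.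

Lemma dotv_rootv_self i j s t :
  i != j -> dotv (rootv i j s t) (rootv i j s t) = 2.
Proof.
move=> ij; rewrite dotv_rootv !rootvE !eqxx (negbTE ij) eq_sym (negbTE ij) /=.
by case: s; case: t; rewrite /=; ring.
Qed.

Lemma Dn_rootP v :
  Dn_root v <-> exists i j s t, i != j /\ v = rootv i j s t.
Proof.
split=> [[i [j [s [t [ij ->]]]]]|[i [j [s [t [ij ->]]]]]].
  by exists i, j, s, t; rewrite -val_eqE neq_ltn ij.
move: ij; rewrite -val_eqE neq_ltn => /orP[] lt; first by exists i, j, s, t.
by rewrite rootvC; exists j, i, t, s.
Qed.

Lemma Dn_root_norm v : Dn_root v -> dotv v v = 2.
Proof.
by move=> /Dn_rootP[i [j [s [t [ij ->]]]]]; apply: dotv_rootv_self.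
Qed.

Lemma mulmx_reflmx2 u f : dotv f f = 2 -> u *m reflmx f = u - dotv u f *: f.
Proof. by move=> f2; rewrite mulmx_reflmx f2 divff ?mul1r ?pnatr_eq0. Qed.

Lemma rootv_neq0 i j s t : i != j -> rootv i j s t != 0.
Proof. by move=> ij; rewrite -dotv_eq0 dotv_rootv_self // pnatr_eq0. Qed.

(** Counting [h_i + h_j] as 1 and [h_i - h_j] as 0, the values add modulo 2 along a path, exactly as
    coboundaries do. *)
Lemma rootv_reflect i j k b c : i != j -> j != k -> i != k ->
  rootv i j false b *m reflmx (rootv j k false c) = rootv i k false (~~ (b (+) c)).
Proof.
move=> ij jk ik; rewrite mulmx_reflmx2 ?dotv_rootv_self //.
rewrite dotv_rootv !rootvE !eqxx [j == i]eq_sym [k == i]eq_sym [k == j]eq_sym.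
rewrite (negbTE ij) (negbTE ik) (negbTE jk); apply/rowP => l.
rewrite mxE [X in _ + X]mxE [X in _ - X]mxE !rootvE.
by case: b; case: c; rewrite /=; ring.
Qed.

Lemma rootv_relabel i j i' j' s t s' t' : i != j ->
  rootv i j s t = rootv i' j' s' t' -> upair (i, j) = upair (i', j').
Proof.
move=> ij E.
have H k : (-1) ^+ s * (k == i)%:R + (-1) ^+ t * (k == j)%:R =
    (-1) ^+ s' * (k == i')%:R + (-1) ^+ t' * (k == j')%:R :> R.
  by rewrite -!rootvE E.
have memi k : k \in [:: i; j] -> k \in [:: i'; j'].
  rewrite !inE; have := H k; case: (eqVneq k i') => //= ki'.
  case: (eqVneq k j') => //= kj'; rewrite !mulr0 addr0.
  case: (eqVneq k i) => [->|_] /=; last first.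
    case: (eqVneq k j) => //= _; rewrite mulr0 mulr1 add0r => /eqP.
    by rewrite signr_eq0.
  by rewrite (negbTE ij) mulr0 mulr1 addr0 => /eqP; rewrite signr_eq0.
have := memi i; have := memi j; rewrite !inE !eqxx orbT /= => /(_ isT) hj /(_ isT).
case/orP=> /eqP ii; case/orP: hj => /eqP jj; subst.
- by rewrite eqxx in ij.
- by [].
- rewrite /upair /=; case: (ltngtP i' j') => //.
  by move=> /val_inj ->.
- by rewrite eqxx in ij.
Qed.

End Vectors.

(** * Reflection groups and the reflections contained in W(D_n) *)

Section Groups.
Variables (R : realType) (n : nat).
Implicit Types (u v w : 'rV[R]_n) (Q M N : 'M[R]_n) (f : 'I_n -> 'rV[R]_n).

Lemma refl_group_gen f k : in_refl_group f (reflmx (f k)).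
Proof. by exists [:: k]; rewrite big_cons big_nil mulmx1. Qed.

Lemma refl_group_mul f M N :
  in_refl_group f M -> in_refl_group f N -> in_refl_group f (M *m N).
Proof.
move=> [s ->] [s' ->]; exists (s ++ s').
elim: s => [|k s IH]; first by rewrite big_nil mul1mx.
by rewrite cat_cons !big_cons -IH mulmxA.
Qed.

Lemma refl_group_refl f v w : v != 0 ->
  in_refl_group f (reflmx v) -> in_refl_group f (reflmx w) ->
  in_refl_group f (reflmx (w *m reflmx v)).
Proof.
move=> v0 gv gw; rewrite -reflmx_conj ?reflmx_tr; last exact: reflmx_orthogonal.
by apply: refl_group_mul => //; apply: refl_group_mul.
Qed.

Lemma refl_group_conj f Q M : orthogonal_mx Q ->
  in_refl_group (fun i => f i *m Q) M <-> in_refl_group f (Q *m M *m Q^T).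
Proof.
move=> oQ; have oQ' := mulmx1C oQ.
have E (s : seq 'I_n) : \big[mulmx/1%:M]_(i <- s) reflmx (f i *m Q) =
    Q^T *m (\big[mulmx/1%:M]_(i <- s) reflmx (f i)) *m Q.
  elim: s => [|k s IH]; first by rewrite !big_nil mulmx1 oQ.
  rewrite !big_cons IH -reflmx_conj // !mulmxA -(mulmxA _ Q Q^T) oQ'.
  by rewrite mulmx1.
split=> [[s ->]|[s sE]]; exists s; last first.
  by rewrite E -sE !mulmxA oQ mul1mx -mulmxA oQ mulmx1.
by rewrite E !mulmxA oQ' mul1mx -mulmxA oQ' mulmx1.
Qed.

Lemma WD_refl v : Dn_root v -> in_WD (reflmx v).
Proof.
move=> rv; exists [:: v]; split; first by move=> w; rewrite inE => /eqP ->.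
by rewrite big_cons big_nil mulmx1.
Qed.

Lemma refl_group_WD f M : in_Delta f -> in_refl_group f M -> in_WD M.
Proof.
move=> fD [s ->]; exists [seq Num.sqrt 2 *: f k | k <- s]; split.
  by move=> v /mapP[k _ ->].
rewrite big_map; apply: eq_bigr => k _; rewrite reflmxZ //.
by rewrite sqrtr_eq0 -ltNge ltr0n.
Qed.

Lemma WD_refl_group f M :
  (forall v, Dn_root v -> in_refl_group f (reflmx v)) ->
  in_WD M -> in_refl_group f M.
Proof.
move=> fr [s [sr ->]]; elim: s sr => [|v s IH] sr.
  by exists [::]; rewrite !big_nil.
rewrite big_cons; apply: refl_group_mul; first by apply/fr/sr/mem_head.
by apply: IH => w ws; apply: sr; rewrite inE ws orbT.
Qed.

(* The sign product distinguishes W(D_n) inside the hyperoctahedral group. *)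
Lemma WD_signed_perm M : in_WD M ->
  exists (p : {perm 'I_n}) (d : 'I_n -> bool),
    (forall i, hb R i *m M = (-1) ^+ d i *: hb R (p i)) /\
    \prod_i (-1) ^+ d i = 1 :> R.
Proof.
move=> [s [sr ->]]; elim: s sr => [|v s IH] sr.
  exists 1%g, (fun=> false); rewrite big_nil; split.
    by move=> i; rewrite mulmx1 perm1 scale1r.
  by rewrite big1.
have /IH[q [c [qE c1]]] : forall w, w \in s -> Dn_root w.
  by move=> w ws; apply: sr; rewrite inE ws orbT.
have /Dn_rootP[i [j [a [b [ij vE]]]]] : Dn_root v by apply: sr; rewrite mem_head.
(* A root reflection swaps coordinates [i] and [j]; it also negates both when the two signs of the
   root agree, and negates nothing otherwise. The sign product stays 1 in either case. *)
pose d k := ((k == i) || (k == j)) && (a == b).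
have dE k : hb R k *m reflmx v = (-1) ^+ d k *: hb R (tperm i j k).
  rewrite vE mulmx_reflmx2 ?dotv_rootv_self // dotv_rootv !hbE /d.
  apply/rowP => l; rewrite mxE [X in _ + X]mxE [X in _ - X]mxE rootvE.
  rewrite [RHS]mxE !hbE.
  case: tpermP => [->|->|/eqP ki /eqP kj].
  - rewrite !eqxx [j == i]eq_sym (negbTE ij) /=.
    by case: a {vE d}; case: b; rewrite /=; ring.
  - rewrite !eqxx (negbTE ij) orbT /=.
    by case: a {vE d}; case: b; rewrite /=; ring.
  - rewrite [i == k]eq_sym [j == k]eq_sym (negbTE ki) (negbTE kj) /=; ring.
exists (tperm i j * q)%g, (fun k => d k (+) c (tperm i j k)); split.
  move=> k; rewrite big_cons mulmxA dE -scalemxAl qE scalerA -signr_addb.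
  by rewrite permM.
under eq_bigr => k _ do rewrite signr_addb.
rewrite big_split /= -(reindex_inj (h := tperm i j) (F := fun k => (-1) ^+ c k)
  (P := xpredT)) /=; last exact: perm_inj.
rewrite c1 mulr1 (bigD1 i) //= (bigD1 j) 1?eq_sym //= big1.
  by rewrite mulr1 /d !eqxx orbT -signr_addb addbb.
by move=> k /andP[/negbTE ki /negbTE kj]; rewrite /d ki kj.
Qed.

(** Off the diagonal the reflection has entries [- v_i * v_j], and a signed permutation matrix has
    one nonzero entry per row. So at most two coordinates of [v] are nonzero, and if there are two,
    both are 1 or -1. A single nonzero coordinate would give the change of one sign, whose sign
    product is -1. *)
Lemma WD_reflP v : dotv v v = 2 -> in_WD (reflmx v) -> Dn_root v.
Proof.
move=> v2 /WD_signed_perm[p [d [pd d1]]].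
have E i j : (j == i)%:R - v 0 i * v 0 j = (-1) ^+ d i * (j == p i)%:R.
  have := congr1 (fun x : 'rV_n => x 0 j) (pd i).
  rewrite /= mulmx_reflmx2 // mxE [X in _ + X]mxE [X in _ - X]mxE !hbE dotvC.
  by rewrite dotv_hb [RHS]mxE hbE.
have pE i j : i != j -> v 0 i != 0 -> v 0 j != 0 -> j = p i.
  move=> ij vi vj; apply/eqP; have := E i j.
  case: (j == p i) => //; rewrite eq_sym (negbTE ij) sub0r mulr0 => /eqP.
  by rewrite oppr_eq0 mulf_eq0 (negbTE vi) (negbTE vj).
have vsq i : p i != i -> v 0 i = (-1) ^+ (v 0 i == -1).
  move=> pi; have := E i i; rewrite eqxx eq_sym (negbTE pi) mulr0 => /eqP.
  rewrite subr_eq0 -expr2 eq_sym sqrf_eq1 => /orP[]/eqP ->; last by rewrite eqxx.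
  by case: eqP => // ?; lra.
have /rV0Pn[i vi] : v != 0 by rewrite -dotv_eq0 v2 pnatr_eq0.
case: (pickP (fun j => (j != i) && (v 0 j != 0))) => [j /andP[ji vj]|v0].
  have pij : p i = j by rewrite -(pE i j) // eq_sym.
  have pji : p j = i by rewrite -(pE j i).
  apply/Dn_rootP; exists i, j, (v 0 i == -1), (v 0 j == -1).
  rewrite eq_sym ji; split=> //; apply/rowP => k; rewrite rootvE -!vsq.
  - case: (eqVneq k i) => [->|ki]; first by rewrite eq_sym (negbTE ji) /=; ring.
    case: (eqVneq k j) => [->|kj]; first by rewrite /=; ring.
    rewrite !mulr0 addr0; apply/eqP; apply: contraNT kj => vk.
    by apply/eqP; rewrite -pij; apply: pE; rewrite // eq_sym.
  - by rewrite pji eq_sym.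
  - by rewrite pij.
have v0' j : j != i -> v 0 j = 0.
  by move=> ji; have := v0 j; rewrite ji /= => /negbFE /eqP.
have vi2 : v 0 i * v 0 i = 2.
  by rewrite -v2 dotvE (bigD1 i) //= big1 ?addr0 // => j /v0' ->; rewrite mul0r.
have dj j : j != i -> (-1) ^+ d j = 1 :> R.
  move=> ji; have := E j j; rewrite v0' // mul0r subr0 eqxx.
  case: (j == p j); last by rewrite mulr0 => /eqP; rewrite oner_eq0.
  by rewrite mulr1.
have di : (-1) ^+ d i = -1 :> R.
  have := E i i; rewrite vi2 eqxx.
  by case: (i == p i); rewrite /= ?mulr1 ?mulr0; [move=> <-; ring | lra].
move: d1; rewrite (bigD1 i) //= big1 // mulr1 di => ?; lra.
Qed.

End Groups.

(** * Families of normals in Delta(D_n) and their edges *)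

Section Families.
Variables (R : realType) (n : nat).
Implicit Types (x v w : 'rV[R]_n) (Q M N : 'M[R]_n) (f g : 'I_n -> 'rV[R]_n).
Implicit Types (e : 'I_n -> 'I_n * 'I_n) (s t : 'I_n -> bool).

(** The order of the two ends in [e k] is an arbitrary choice; [s k] and [t k] are the signs at the
    first and the second end. *)
Definition realizes f e s t : Prop := forall k, (e k).1 != (e k).2 /\
  Num.sqrt 2 *: f k = rootv R (e k).1 (e k).2 (s k) (t k).

Lemma sqrt2_neq0 : Num.sqrt 2 != 0 :> R.
Proof. by rewrite sqrtr_eq0 -ltNge ltr0n. Qed.

Lemma in_DeltaP f : in_Delta f <-> exists e s t, realizes f e s t.
Proof.
split=> [fD|[e [s [t H]]] k]; last first.
  by case: (H k) => ne ->; apply/Dn_rootP; exists (e k).1, (e k).2, (s k), (t k).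
have /fin_all_exists[e /fin_all_exists[s /fin_all_exists[t H]]] :
    forall k, exists (ek : 'I_n * 'I_n) (sk tk : bool),
      ek.1 != ek.2 /\ Num.sqrt 2 *: f k = rootv R ek.1 ek.2 sk tk.
  move=> k; have /Dn_rootP[i [j [s [t H]]]] := fD k.
  by exists (i, j), s, t.
by exists e, s, t.
Qed.

Lemma sqrt2_norm v :
  dotv v v = 1 <-> dotv (Num.sqrt 2 *: v) (Num.sqrt 2 *: v) = 2.
Proof.
rewrite dotvZl dotvZr mulrA -expr2 sqr_sqrtr ?ler0n //.
by split=> E; lra.
Qed.

Lemma row_free_orth f x :
  row_free (\matrix_i f i) -> (forall k, dotv x (f k) = 0) -> x = 0.
Proof.
rewrite row_free_unit -unitmx_tr => fu xf.
apply: (can_inj (mulmxK fu)); rewrite mul0mx; apply/rowP => k.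
rewrite [RHS]mxE -(xf k) dotvE mxE.
by apply: eq_bigr => i _; rewrite !mxE.
Qed.

Lemma row_free_distinct f k l : row_free (\matrix_i f i) ->
  f k = f l \/ f k = - f l -> k = l.
Proof.
move=> ff kl; apply/eqP; apply/negPn/negP => nkl.
case/negP: (oner_neq0 R); apply/eqP.
(* The sign is chosen so that [f k + c *: f l] vanishes, which is a nontrivial linear relation. *)
pose c : R := if f k == f l then -1 else 1.
have E : (delta_mx 0 k + c *: delta_mx 0 l : 'rV_n) *m (\matrix_i f i) = 0.
  rewrite mulmxDl -scalemxAl -!rowE !rowK /c.
  case: eqP => [->|ne]; first by rewrite scaleN1r addrN.
  by case: kl => // ->; rewrite scale1r addNr.
have := congr1 (fun y : 'rV_n => y 0 k)
  (row_free_inj ff (etrans E (esym (mul0mx _ _)))).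
by rewrite !mxE !eqxx (negbTE nkl) mulr0 addr0.
Qed.

Lemma realizes_dot f e s t x k : realizes f e s t ->
  (dotv x (f k) == 0) =
  ((-1) ^+ s k * x 0 (e k).1 + (-1) ^+ t k * x 0 (e k).2 == 0).
Proof.
move=> H; case: (H k) => _ E; rewrite -dotv_rootv -E dotvZr mulf_eq0.
by rewrite (negbTE sqrt2_neq0).
Qed.

(* A coboundary presentation of the signs yields a vector with entries +-1
   orthogonal to the whole family. *)
Lemma row_free_noncoboundary f e s t : (0 < n)%N -> realizes f e s t ->
  row_free (\matrix_i f i) -> ~ coboundary e (fun k => s k == t k).
Proof.
move=> n0 H ff [d dE].
have /rowP/(_ (Ordinal n0)) : \row_i (-1) ^+ d i = 0 :> 'rV[R]_n.
  apply: (row_free_orth ff) => k; apply/eqP; rewrite (realizes_dot _ _ H) !mxE.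
  rewrite -!signr_addb; have := dE k.
  by case: (s k); case: (t k); case: (d (e k).1); case: (d (e k).2) => //= _;
    rewrite ?expr0 ?expr1 ?addrN ?addNr.
by rewrite !mxE => /eqP; rewrite signr_eq0.
Qed.

(** A nonzero vector [x] orthogonal to all normals has equal squares at the ends of each edge. By
    connectedness all its entries agree up to sign, and the set of entries with a given sign
    presents the pattern as a coboundary. *)
Lemma noncoboundary_row_free f e s t : realizes f e s t -> econn e ->
  ~ coboundary e (fun k => s k == t k) -> row_free (\matrix_i f i).
Proof.
move=> H ce ncob; apply: contrapT => /negP nf; apply: ncob.
have : kermx (\matrix_i f i)^T != 0.
  by rewrite kermx_eq0 row_free_unit unitmx_tr -row_free_unit.
move=> /rowV0Pn[x /sub_kermxP xf x0].
have xk k : (-1) ^+ s k * x 0 (e k).1 + (-1) ^+ t k * x 0 (e k).2 = 0.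
  apply/eqP; rewrite -(realizes_dot _ _ H) dotvE.
  have := congr1 (fun y : 'rV_n => y 0 k) xf.
  rewrite mxE [RHS]mxE => xf0; apply/eqP; rewrite -[RHS]xf0.
  by apply: eq_bigr => i _; rewrite !mxE.
have sq k : x 0 (e k).1 ^+ 2 = x 0 (e k).2 ^+ 2.
  have := xk k => /eqP; rewrite addr_eq0 => /eqP E.
  rewrite -[LHS]mul1r -(sqrr_sign _ (s k)) -exprMn E sqrrN exprMn sqrr_sign.
  by rewrite mul1r.
have /rV0Pn[i xi] := x0.
have xj j : (x 0 j == x 0 i) || (x 0 j == - x 0 i).
  by rewrite -eqf_sqr; apply/eqP; apply: (econn_eq (c := fun j => x 0 j ^+ 2) ce).
exists (fun j => x 0 j == x 0 i) => k; have := xk k.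
have xN : (- x 0 i == x 0 i) = false.
  by apply/eqP => E; case/negP: xi; apply/eqP; lra.
by case/orP: (xj (e k).1) => /eqP ->; case/orP: (xj (e k).2) => /eqP ->;
  case: (s k); case: (t k); rewrite ?eqxx ?xN //= => E;
  case/negP: xi; apply/eqP; lra.
Qed.

Lemma realizes_family f e s t : realizes f e s t -> econn e ->
  ~ coboundary e (fun k => s k == t k) -> is_family f.
Proof.
move=> H ce nc; split; last exact: noncoboundary_row_free H ce nc.
by move=> k; apply/sqrt2_norm; case: (H k) => ne ->; apply: dotv_rootv_self.
Qed.

(** Up to a global sign, [b = false] stands for the root [h_i + h_j] and [b = true] for
    [h_i - h_j]. *)
Definition linked f i j (b : bool) : Prop :=
  i != j /\ in_refl_group f (reflmx (rootv R i j false b)).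

Lemma linked_sym f i j b : linked f i j b -> linked f j i b.
Proof.
move=> [ij h]; split; first by rewrite eq_sym.
case: b h => h; last by rewrite rootvC.
by rewrite rootvC -[rootv _ _ _ _ _]opprK rootvN reflmxN.
Qed.

Lemma linked_trans f i j k b c : i != k ->
  linked f i j b -> linked f j k c -> linked f i k (~~ (b (+) c)).
Proof.
move=> ik [ij hb] [jk hc]; split; first exact: ik.
by rewrite -(rootv_reflect R b c ij jk ik); apply: refl_group_refl;
  rewrite ?rootv_neq0.
Qed.

Lemma linked_gen f e s t k : realizes f e s t ->
  linked f (e k).1 (e k).2 (s k (+) t k).
Proof.
move=> H; case: (H k) => ne E; split=> //.
suff -> : reflmx (rootv R (e k).1 (e k).2 false (s k (+) t k)) = reflmx (f k).
  exact: refl_group_gen.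
rewrite -(reflmxZ (f k) sqrt2_neq0) E.
case: (s k) => //; rewrite -[RHS]reflmxN rootvN /=.
by case: (t k).
Qed.

Lemma realizes_full_group f e s t v : (0 < n)%N -> realizes f e s t ->
  econn e -> row_free (\matrix_i f i) -> Dn_root v ->
  in_refl_group f (reflmx v).
Proof.
move=> n0 H ce ff.
have ncob := row_free_noncoboundary n0 H ff.
(* The vertices reachable from [i] by available roots form a colouring constant along edges, hence
   contain every vertex. *)
have some_link i j : i != j -> exists b, linked f i j b.
  move=> ij; pose c l := `[< l = i \/ exists b, linked f i l b >].
  have step k l b : linked f k l b -> c k -> c l.
    move=> kl /asboolP[kE|[a ik]]; apply/asboolP; rewrite /c.
      by right; exists b; rewrite -kE.
    have [->|li] := eqVneq l i; first by left.
    by right; eexists; apply: linked_trans ik kl; rewrite eq_sym.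
  have cE k : c (e k).1 = c (e k).2.
    have lk := linked_gen k H.
    by apply/idP/idP; apply: step; [exact: lk | exact: linked_sym lk].
  have : c j by rewrite (ce c cE j i); apply/asboolP; left.
  by move=> /asboolP[ji|//]; rewrite ji eqxx in ij.
(* If no pair carried both roots, letting [d j] tell whether [h_i0 + h_j] is available would write
   the sign pattern as a coboundary, against independence. *)
have [i [j [lt lf]]] : exists i j, linked f i j true /\ linked f i j false.
  apply: contrapT => none; apply: ncob.
  pose i0 := Ordinal n0.
  pose d j := `[< linked f i0 j false >].
  have d_ne j : d j -> i0 != j by case/asboolP.
  have dP j b : linked f i0 j b -> d j = ~~ b.
    case: b => lj; apply/asboolP => //= lj'; apply: none; by exists i0, j.
  have dN j : i0 != j -> linked f i0 j (~~ d j).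
    by move=> /some_link[b lj]; rewrite (dP _ _ lj) negbK.
  have d0 : d i0 = false by apply/negP => /d_ne; rewrite eqxx.
  exists d => k; have lk := linked_gen k H; have [ne _] := H k.
  have -> : (s k == t k) = ~~ (s k (+) t k) by case: (s k); case: (t k).
  move: lk; set b := _ (+) _ => lk.
  case: (eqVneq i0 (e k).1) => [i0E|n1].
    by rewrite -i0E d0 in lk *; rewrite (dP _ _ lk).
  case: (eqVneq i0 (e k).2) => [i0E|n2].
    have lk' := linked_sym lk.
    by rewrite -i0E d0 in lk' *; rewrite (dP _ _ lk') addbF.
  rewrite (dP _ _ (linked_trans n2 (dN _ n1) lk)).
  by case: (d _); rewrite /= ?negbK.
(* Reflecting both roots on [i], [j] along one root on [j], [k] gives both roots on [i], [k]. *)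
have both_from k : i != k -> forall b, linked f i k b.
  move=> ik b; have [<-|jk] := eqVneq j k; first by case: b.
  have [c jc] := some_link j k jk.
  have l1 := linked_trans ik lt jc; have l2 := linked_trans ik lf jc.
  by case: b; case: c jc l1 l2.
have both k l : k != l -> forall b, linked f k l b.
  move=> kl b; have [ik|ik] := eqVneq i k.
    by rewrite -ik in kl *; apply: both_from.
  have ki : linked f k i (~~ b) by apply/linked_sym/both_from.
  have [<-|il] := eqVneq i l; first by apply/linked_sym/both_from.
  have := linked_trans kl ki (both_from l il false).
  by rewrite addbF negbK.
move=> /Dn_rootP[k [l [a [b [kl ->]]]]].
have [_] := both k l kl (a (+) b).
by case: a => //=; rewrite -reflmxN rootvN /= negbK.
Qed.

Lemma realizes_generates f e s t M : (0 < n)%N -> realizes f e s t ->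
  econn e -> row_free (\matrix_i f i) -> in_refl_group f M <-> in_WD M.
Proof.
move=> n0 H ce ff; split; first by apply: refl_group_WD; apply/in_DeltaP; exists e, s, t.
by apply: WD_refl_group => v; apply: realizes_full_group.
Qed.

Lemma realizes_generates_Dn f e s t : (0 < n)%N -> realizes f e s t ->
  econn e -> row_free (\matrix_i f i) -> generates_Dn f.
Proof.
move=> n0 H ce ff; exists 1%:M; split; first exact: orthogonal1.
by move=> M; rewrite trmx1 mulmx1 mul1mx; apply: realizes_generates H ce ff.
Qed.

(* Schur's lemma for W(D_n); applied to the projection onto a union of connected
   components, it shows that the graph of a generating family is connected. *)
Lemma WD_commutant N : (3 <= n)%N ->
  (forall v, Dn_root v -> N *m reflmx v = reflmx v *m N) ->
  exists a, N = a%:M.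
Proof.
move=> n3 comm.
have two0 : (2 : R) != 0 by rewrite pnatr_eq0.
(* Commuting with a reflection means preserving its eigenline for -1, which is spanned by the
   root. *)
have eig v : Dn_root v -> exists a, v *m N = a *: v.
  move=> rv; have v2 := Dn_root_norm rv; exists (dotv (v *m N) v / 2).
  have : v *m reflmx v *m N = v *m N *m reflmx v by rewrite -!mulmxA comm.
  rewrite !mulmx_reflmx2 // v2 mulmxBl -scalemxAl scaler_nat mulr2n opprD addrA.
  rewrite addrN add0r => E; apply: (scalerI two0).
  rewrite scalerA mulrC divfK ?pnatr_eq0 // scaler_nat mulr2n.
  by rewrite -{1}[v *m N]opprK E opprB addrNK.
have rowN i l : (hb R i *m N) 0 l = N i l by rewrite -rowE mxE.
have eigE i j (s t : bool) : i != j -> exists a, forall l,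
    (-1) ^+ s * N i l + (-1) ^+ t * N j l =
    a * ((-1) ^+ s * (l == i)%:R + (-1) ^+ t * (l == j)%:R).
  move=> ij; have [|a aE] := eig (rootv R i j s t).
    by apply/Dn_rootP; exists i, j, s, t.
  exists a => l; have := congr1 (fun x : 'rV_n => x 0 l) aE.
  rewrite /= [RHS]mxE rootvE => <-.
  rewrite mulmxDl -!scalemxAl [RHS]mxE [X in _ = X + _]mxE [X in _ = _ + X]mxE.
  by rewrite !rowN.
have off i l : i != l -> N i l = 0.
  move=> il.
  (* With three coordinates available there is a third index [j]; coordinate [l] of the images of
     [h_i + h_j] and [h_i - h_j] is 0, so both [N i l + N j l] and [N i l - N j l] vanish. *)
  case: (pickP (fun j => (j != i) && (j != l))) => [j /andP[ji jl]|all2]; last first.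
    have : (#|'I_n| <= #|[set i; l]|)%N.
      apply: subset_leq_card; apply/subsetP => j _.
      by have := all2 j; rewrite !inE => /negbT; rewrite negb_and !negbK.
    by rewrite card_ord cards2 il => /(leq_trans n3).
  have ij : i != j by rewrite eq_sym.
  have [a /(_ l) aE] := eigE i j false false ij.
  have [b /(_ l) bE] := eigE i j false true ij.
  move: aE bE; rewrite [l == i]eq_sym [l == j]eq_sym (negbTE il) (negbTE jl) /=.
  by move=> *; lra.
have diag i j : N i i = N j j.
  have [->//|ij] := eqVneq i j.
  have [a aE] := eigE i j false false ij.
  have := aE i; have := aE j; rewrite !eqxx [j == i]eq_sym (negbTE ij) /=.
  by rewrite (off _ _ ij) (off j i) 1?eq_sym // => *; lra.
have i0 : 'I_n := Ordinal (ltnW (ltnW n3)).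
exists (N i0 i0); apply/matrixP => i j; rewrite mxE.
by case: (eqVneq i j) => [<-|ij]; [rewrite (diag i i0) mulr1n | rewrite off].
Qed.

Lemma generates_econn f e s t : (3 <= n)%N -> realizes f e s t ->
  generates_Dn f -> econn e.
Proof.
move=> n3 H [Q [oQ QE]] c cE i j; have oQ' := mulmx1C oQ.
(* This is the projection onto the coordinates coloured [true]. Both ends of an edge have the same
   colour, so every [f k] is an eigenvector of [P] and [P] commutes with the whole group. *)
pose P : 'M[R]_n := diag_mx (\row_k (c k)%:R).
have xP x : x *m P = \row_k (x 0 k * (c k)%:R).
  by apply/rowP => k; rewrite mul_mx_diag !mxE.
have commf k : P *m reflmx (f k) = reflmx (f k) *m P.
  have [ne fE] := H k; rewrite -(reflmxZ (f k) sqrt2_neq0) fE.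
  set v := rootv _ _ _ _ _.
  have vP : v *m P = (c (e k).1)%:R *: v.
    rewrite xP; apply/rowP => l; rewrite mxE [RHS]mxE rootvE mulrC.
    case: (eqVneq l (e k).1) => [->//|n1].
    case: (eqVneq l (e k).2) => [->|n2]; first by rewrite cE.
    by rewrite !mulr0 addr0 !mulr0.
  have Pt : P^T = P by rewrite /P tr_diag_mx.
  have Pv : P *m v^T = (c (e k).1)%:R *: v^T.
    by rewrite -{1}Pt -trmx_mul vP linearZ.
  rewrite /reflmx mulmxBr mulmxBl mulmx1 mul1mx -scalemxAr -scalemxAl.
  by rewrite (mulmxA P) Pv -(mulmxA _ _ P) vP -scalemxAl -scalemxAr.
have commG M : in_refl_group f M -> P *m M = M *m P.
  move=> [r ->]; elim: r => [|k r IH]; first by rewrite big_nil mulmx1 mul1mx.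
  by rewrite big_cons mulmxA commf -!mulmxA IH.
have [a aE] : exists a, Q^T *m P *m Q = a%:M.
  apply: WD_commutant => // v /WD_refl rv.
  have := commG (Q *m reflmx v *m Q^T).
  case: (QE (Q *m reflmx v *m Q^T)) => _ H'; rewrite !mulmxA in H' *.
  rewrite oQ mul1mx -(mulmxA _ Q^T Q) oQ mulmx1 in H'.
  move=> /(_ (H' rv)) E; have := congr1 (fun X => Q^T *m X *m Q) E.
  by rewrite !mulmxA oQ mul1mx -(mulmxA _ Q^T Q) oQ mulmx1 => ->.
have PE : P = a%:M.
  have := congr1 (fun X => Q *m X *m Q^T) aE.
  rewrite !mulmxA oQ' mul1mx -mulmxA oQ' mulmx1 => ->.
  by rewrite mul_mx_scalar -scalemxAl oQ' scalemx1.
have cP k : (c k)%:R = a.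
  have := congr1 (fun X : 'M_n => X k k) PE.
  by rewrite !mxE eqxx !mulr1n.
have := etrans (cP i) (esym (cP j)).
by case: (c i); case: (c j) => // /eqP; rewrite ?oner_eq0 // eq_sym oner_eq0.
Qed.

End Families.

(** * The graph of a family *)

Lemma upairP (n : nat) (x y : 'I_n * 'I_n) :
  upair x = upair y <-> x = y \/ x = (y.2, y.1).
Proof.
case: x y => [i j] [k l]; rewrite /upair /=; split; last first.
  case=> [[-> ->]//|[-> ->]].
  by case: (ltngtP k l) => // /val_inj ->.
by case: leqP => _; case: leqP => _ [-> ->]; auto.
Qed.

Lemma upair_id (n : nat) (x : 'I_n * 'I_n) : upair (upair x) = upair x.
Proof.
by case: x => i j; rewrite /upair /=; case: (leqP i j) => /= [->|/ltnW ->].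
Qed.

Lemma upair_lt (n : nat) (i j : 'I_n) : (i < j)%N -> upair (i, j) = (i, j).
Proof. by move=> /ltnW lt; rewrite /upair /= lt. Qed.

Section Graph.
Variables (R : realType) (n : nat).
Implicit Types (f g : 'I_n -> 'rV[R]_n).
Implicit Types (e : 'I_n -> 'I_n * 'I_n) (s t : 'I_n -> bool).

Lemma rootv_inj (i j i' j' : 'I_n) (s t s' t' : bool) : i != j ->
  rootv R i j s t = rootv R i' j' s' t' ->
  [/\ i = i', j = j', s = s' & t = t'] \/ [/\ i = j', j = i', s = t' & t = s'].
Proof.
have key (k l : 'I_n) (a b c d : bool) : k != l ->
    rootv R k l a b = rootv R k l c d -> a = c /\ b = d.
  move=> kl /rowP E; have := E k; have := E l.
  rewrite !rootvE !eqxx [l == k]eq_sym (negbTE kl) !mulr0 addr0 !add0r !mulr1.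
  by rewrite addr0 => /signr_inj -> /signr_inj ->.
move=> ij E; have /upairP[[ii jj]|[ii jj]] := rootv_relabel ij E; subst.
  by left; have [-> ->] := key _ _ _ _ _ _ ij E.
right; move: E; rewrite [RHS]rootvC => E.
by have [-> ->] := key _ _ _ _ _ _ ij E.
Qed.

Lemma rootv_edge (x : 'I_n * 'I_n) (i j : 'I_n) (s t s' t' : bool) :
  x.1 != x.2 -> rootv R x.1 x.2 s t = rootv R i j s' t' -> upair x = upair (i, j).
Proof. by case: x => k l; apply: rootv_relabel. Qed.

Lemma realizes_parallel f e s t k l : realizes f e s t ->
  upair (e k) = upair (e l) -> (s k == t k) = (s l == t l) ->
  f k = f l \/ f k = - f l.
Proof.
move=> H kl st; have [_ fk] := H k; have [_ fl] := H l.
have inj2 := scalerI (sqrt2_neq0 R).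
have E : rootv R (e k).1 (e k).2 (s k) (t k) = rootv R (e l).1 (e l).2 (s l) (t l)
   \/ rootv R (e k).1 (e k).2 (s k) (t k) = - rootv R (e l).1 (e l).2 (s l) (t l).
  rewrite rootvN; case/upairP: kl st => ->.
    by case: (s k); case: (t k); case: (s l); case: (t l) => //=; auto.
  rewrite /= (rootvC R (e l).2); move: (e l).1 (e l).2 => i j.
  by case: (s k); case: (t k); case: (s l); case: (t l) => //=; auto.
case: E => E; [left | right]; apply: inj2; first by rewrite fk fl.
by rewrite scalerN fk fl.
Qed.

Lemma plus_occE f e s t (i j : 'I_n) : realizes f e s t -> (i < j)%N ->
  plus_occ f i j = [exists k, (upair (e k) == (i, j)) && (s k == t k)].
Proof.
move=> H lt; have ij : i != j by rewrite -val_eqE neq_ltn lt.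
apply: eq_existsb => k; have [ne ->] := H k.
have -> : hb R i + hb R j = rootv R i j false false by rewrite /rootv !scale1r.
rewrite rootvN -[X in upair _ == X](upair_lt lt).
apply/idP/idP => [/orP[]/eqP E|/andP[/eqP/upairP[]-> /eqP ->]] /=.
- by rewrite (rootv_edge ne E) eqxx; case: (rootv_inj ne E) => [] [_ _ -> ->].
- by rewrite (rootv_edge ne E) eqxx; case: (rootv_inj ne E) => [] [_ _ -> ->].
- by case: (t k); rewrite eqxx ?orbT.
- by case: (t k); rewrite rootvC eqxx ?orbT.
Qed.

Lemma minus_occE f e s t (i j : 'I_n) : realizes f e s t -> (i < j)%N ->
  minus_occ f i j = [exists k, (upair (e k) == (i, j)) && (s k != t k)].
Proof.
move=> H lt; have ij : i != j by rewrite -val_eqE neq_ltn lt.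
apply: eq_existsb => k; have [ne ->] := H k.
have -> : hb R i - hb R j = rootv R i j false true.
  by rewrite /rootv scale1r scaleN1r.
have -> : hb R j - hb R i = rootv R i j true false.
  by rewrite rootvC /rootv scale1r scaleN1r.
rewrite -[X in upair _ == X](upair_lt lt).
apply/idP/idP => [/orP[]/eqP E|/andP[/eqP/upairP[]-> st]] /=.
- by rewrite (rootv_edge ne E) eqxx; case: (rootv_inj ne E) => [] [_ _ -> ->].
- by rewrite (rootv_edge ne E) eqxx; case: (rootv_inj ne E) => [] [_ _ -> ->].
- by move: st; case: (t k); case: (s k) => // _; rewrite eqxx ?orbT.
- by move: st; case: (t k); case: (s k) => // _; rewrite rootvC eqxx ?orbT.
Qed.

Lemma mem_all_pairs (x : 'I_n * 'I_n) : x \in all_pairs n.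
Proof. by apply/allpairsP; exists x; rewrite !mem_enum; case: x. Qed.

Lemma uniq_all_pairs : uniq (all_pairs n).
Proof. by rewrite allpairs_uniq ?enum_uniq // => -[? ?] [? ?]. Qed.

Lemma graph_of_lt f x : x \in graph_of f -> (x.1 < x.2)%N.
Proof. by rewrite mem_cat !mem_filter => /orP[]/andP[/andP[]]. Qed.

Lemma graph_of_upair f : [seq upair x | x <- graph_of f] = graph_of f.
Proof.
rewrite -[RHS]map_id; apply/eq_in_map => -[i j] /graph_of_lt /=.
exact: upair_lt.
Qed.

Lemma graph_of_perm f e s t : realizes f e s t -> row_free (\matrix_i f i) ->
  perm_eq (graph_of f) [seq upair (e k) | k <- enum 'I_n].
Proof.
move=> H ff.
(* Plus and minus edges are compared separately: within one type no two normals share a pair of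
   vertices, so both lists are duplicate-free and only membership matters. *)
have half (occ : 'I_n -> 'I_n -> bool) (P : pred 'I_n) :
    (forall i j : 'I_n, (i < j)%N -> occ i j = [exists k, (upair (e k) == (i, j)) && P k]) ->
    {in P &, forall k l, (s k == t k) = (s l == t l)} ->
    perm_eq [seq p : 'I_n * 'I_n <- all_pairs n | (p.1 < p.2)%N && occ p.1 p.2]
      [seq upair (e k) | k <- enum 'I_n & P k].
  move=> occE PE; apply: uniq_perm.
  - exact/filter_uniq/uniq_all_pairs.
  - rewrite map_inj_in_uniq; first exact/filter_uniq/enum_uniq.
    move=> k l.
    rewrite !mem_filter => /andP[Pk _] /andP[Pl _] kl.
    by apply: (row_free_distinct ff); apply: (realizes_parallel H kl); apply: PE.
  - move=> [i j]; rewrite mem_filter mem_all_pairs andbT /=.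
    apply/idP/mapP => [/andP[lt]|[k]].
      rewrite occE // => /existsP[k /andP[/eqP ek Pk]].
      by exists k => //; rewrite mem_filter mem_enum andbT.
    rewrite mem_filter => /andP[Pk _] ijE.
    have lt : (i < j)%N.
      have [ne _] := H k; case: (e k) ne ijE => a b /= ne.
      rewrite /upair /=; case: (leqP a b) => le [-> ->] //.
      by rewrite ltn_neqAle val_eqE ne.
    by rewrite lt occE //; apply/existsP; exists k; rewrite -ijE eqxx.
pose P k := s k == t k.
have /permPr <- := perm_map (fun k => upair (e k)) (permEl (perm_filterC P (enum 'I_n))).
rewrite map_cat; apply: perm_cat; apply: half.
- by move=> i j; apply: plus_occE.
- by move=> k l; rewrite -!topredE /= /P => -> ->.
- by move=> i j; apply: minus_occE.
- by move=> k l; rewrite -!topredE /= /P => /negbTE -> /negbTE ->.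
Qed.

Lemma graph_of_in_M f e s t : (0 < n)%N -> realizes f e s t ->
  row_free (\matrix_i f i) -> econn e -> in_M (graph_of f).
Proof.
move=> n0 H ff ce; have pG := graph_of_perm H ff.
have lG : loopless (graph_of f).
  by apply/allP => x /graph_of_lt; rewrite -val_eqE neq_ltn => ->.
have cG : mg_connected (graph_of f).
  rewrite mg_connectedP => c cE; apply: ce => k.
  have : upair (e k) \in graph_of f.
    by rewrite (perm_mem pG); apply/mapP; exists k; rewrite ?mem_enum.
  by move=> /cE; rewrite /upair; case: ifP.
split=> //; apply/(unicyclic_size n0 lG cG).
by rewrite (perm_size pG) size_map size_enum_ord.
Qed.

End Graph.

(** * Isometries of families *)

Lemma perm_eq_enum (n : nat) (T : eqType) (F G : 'I_n -> T) :
  perm_eq [seq F k | k <- enum 'I_n] [seq G k | k <- enum 'I_n] ->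
  exists p : {perm 'I_n}, forall k, F k = G (p k).
Proof.
have E (H : 'I_n -> T) : [seq H k | k <- enum 'I_n] = [tuple H k | k < n].
  by [].
rewrite !E => /tuple_permP[p pE]; exists p => k.
have /val_inj FG : val [tuple F k | k < n] =
    val [tuple tnth [tuple G k | k < n] (p i) | i < n] by [].
by have := congr1 (fun z : n.-tuple T => tnth z k) FG; rewrite !tnth_mktuple.
Qed.

Section Isometries.
Variables (R : realType) (n : nat).
Implicit Types (Q : 'M[R]_n) (f g : 'I_n -> 'rV[R]_n).
Implicit Types (e : 'I_n -> 'I_n * 'I_n) (s t : 'I_n -> bool).

Lemma orthogonal_unit Q : orthogonal_mx Q -> Q \in unitmx.
Proof. by move=> oQ; case: (mulmx1_unit oQ). Qed.

Lemma row_free_orthogonal f Q : orthogonal_mx Q ->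
  row_free (\matrix_i (f i *m Q)) = row_free (\matrix_i f i).
Proof.
move=> oQ; have -> : \matrix_i (f i *m Q) = \matrix_i f i *m Q.
  by apply/row_matrixP => i; rewrite row_mul !rowK.
by rewrite !row_free_unit unitmx_mul (orthogonal_unit oQ) andbT.
Qed.

Lemma row_free_perm f (p : {perm 'I_n}) :
  row_free (\matrix_i f (p i)) = row_free (\matrix_i f i).
Proof.
have -> : \matrix_i f (p i) = row_perm p (\matrix_i f i).
  by apply/matrixP => i j; rewrite !mxE.
by rewrite row_permE !row_free_unit unitmx_mul unitmx_perm.
Qed.

Lemma family_orthogonal f Q : orthogonal_mx Q ->
  is_family f -> is_family (fun k => f k *m Q).
Proof.
move=> oQ [f1 ff]; split; last by rewrite row_free_orthogonal.
by move=> k; rewrite dotv_orthogonal.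
Qed.

Lemma isometricP f g : row_free (\matrix_i f i) ->
  isometric f g <-> exists Q (p : {perm 'I_n}), orthogonal_mx Q /\
    forall k, f k *m Q = g (p k) \/ f k *m Q = - g (p k).
Proof.
move=> ff; split=> [[Q [oQ sf]]|[Q [p [oQ pE]]]].
  have /fin_all_exists[h hE] : forall k, exists l, f k *m Q = g l \/ f k *m Q = - g l.
    by move=> k; apply/(sf (f k *m Q)); exists k; left.
  (* Two normals sent to the same [g l] up to sign would coincide up to sign, against
     independence. *)
  have hI : injective h.
    move=> k l kl; apply: (row_free_distinct (f := fun i => f i *m Q)).
      by rewrite row_free_orthogonal.
    have := hE k; have := hE l; rewrite kl.
    by case=> ->; case=> ->; rewrite ?opprK; auto.
  by exists Q, (perm hI); split=> // k; rewrite permE.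
exists Q; split=> // v; split=> [[k vE]|[k vE]].
  by exists (p k); case: vE => ->; case: (pE k) => ->; rewrite ?opprK; auto.
exists (p^-1%g k); have := pE (p^-1%g k); rewrite permKV.
by case: vE => ->; case=> ->; rewrite ?opprK; auto.
Qed.

Lemma refl_groupS f g M :
  (forall k, in_refl_group g (reflmx (f k))) ->
  in_refl_group f M -> in_refl_group g M.
Proof.
move=> fg [r ->]; elim: r => [|k r IH]; first by exists [::]; rewrite !big_nil.
by rewrite big_cons; apply: refl_group_mul.
Qed.

Lemma same_family_refl_group f g M :
  same_family f g -> in_refl_group f M <-> in_refl_group g M.
Proof.
move=> fg; split; apply: refl_groupS => k.
  have [l lE] : exists l, f k = g l \/ f k = - g l.
    by apply/(fg (f k)); exists k; left.
  by case: lE => ->; rewrite ?reflmxN; apply: refl_group_gen.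
have [l lE] : exists l, g k = f l \/ g k = - f l.
  by apply/(fg (g k)); exists k; left.
by case: lE => ->; rewrite ?reflmxN; apply: refl_group_gen.
Qed.

Lemma isometric_generates f g :
  isometric f g -> generates_Dn f -> generates_Dn g.
Proof.
move=> [Q [oQ fg]] [Q0 [oQ0 fE]]; exists (Q^T *m Q0); split.
  by apply: orthogonal_mul => //; apply: orthogonal_tr.
move=> M; rewrite -(same_family_refl_group M fg) refl_group_conj // fE.
by rewrite trmx_mul trmxK !mulmxA.
Qed.

Lemma realizes_reorient f e e' s t : realizes f e s t ->
  (forall k, upair (e' k) = upair (e k)) ->
  exists s' t', realizes f e' s' t'.
Proof.
move=> H ee'.
suff /fin_all_exists[s' /fin_all_exists[t' H']] : forall k, exists sk tk : bool,
    (e' k).1 != (e' k).2 /\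
    Num.sqrt 2 *: f k = rootv R (e' k).1 (e' k).2 sk tk.
  by exists s', t'.
move=> k; have [ne E] := H k; case/upairP: (ee' k) => ->.
  by exists (s k), (t k).
by exists (t k), (s k); rewrite eq_sym rootvC.
Qed.

Definition sign_mx (d : 'I_n -> bool) : 'M[R]_n := diag_mx (\row_i (-1) ^+ d i).

Lemma sign_mx_orthogonal d : orthogonal_mx (sign_mx d).
Proof.
rewrite /orthogonal_mx /sign_mx tr_diag_mx; apply/matrixP => i j.
rewrite mul_mx_diag !mxE; case: eqP => [->|_]; last by rewrite mul0r.
by rewrite mulr1n -expr2 sqrr_sign.
Qed.

Lemma rootv_sign_mx d (i j : 'I_n) (s t : bool) :
  rootv R i j s t *m sign_mx d = rootv R i j (s (+) d i) (t (+) d j).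
Proof.
apply/rowP => k; rewrite mul_mx_diag mxE !rootvE !signr_addb mxE mulrDl.
by congr (_ + _); rewrite mulrAC -!mulrA;
  [case: (eqVneq k i) => [->|]| case: (eqVneq k j) => [->|]];
  rewrite ?mulr0 ?mul0r ?mulr1 ?mul1r.
Qed.

Lemma perm_mx_orthogonal (p : {perm 'I_n}) : orthogonal_mx (perm_mx p : 'M[R]_n).
Proof. by rewrite /orthogonal_mx tr_perm_mx -perm_mxM mulVg perm_mx1. Qed.

Lemma rootv_perm_mx (p : {perm 'I_n}) (i j : 'I_n) (s t : bool) :
  rootv R i j s t *m perm_mx p = rootv R (p i) (p j) s t.
Proof.
have E (k : 'I_n) : hb R k *m perm_mx p = hb R (p k).
  by apply/rowP => l; rewrite -rowE !mxE eqxx eq_sym.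
by rewrite mulmxDl -!scalemxAl !E.
Qed.

Lemma realizes_orthogonal f e s t e' s' t' Q : realizes f e s t ->
  (forall k, (e' k).1 != (e' k).2) ->
  (forall k, rootv R (e k).1 (e k).2 (s k) (t k) *m Q =
             rootv R (e' k).1 (e' k).2 (s' k) (t' k)) ->
  realizes (fun k => f k *m Q) e' s' t'.
Proof. by move=> H ne QE k; split=> //; rewrite scalemxAl (H k).2. Qed.

Lemma econn_perm (p : {perm 'I_n}) e :
  econn e -> econn (fun k => (p (e k).1, p (e k).2)).
Proof.
move=> ce c cE i j.
have := ce (fun k => c (p k)) cE (p^-1%g i) (p^-1%g j).
by rewrite !permKV.
Qed.

End Isometries.

(** Both sign patterns are noncoboundaries, so their difference is a coboundary of some [d];
    changing the signs of the coordinates marked by [d] carries one family to the other up to signs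
    of the normals. *)
Lemma same_edges_switching (R : realType) (n : nat)
    (f g : 'I_n.+1 -> 'rV[R]_n.+1) e s t s' t' :
  realizes f e s t -> realizes g e s' t' -> econn e ->
  row_free (\matrix_i f i) -> row_free (\matrix_i g i) ->
  exists Q, orthogonal_mx Q /\ forall k, f k *m Q = g k \/ f k *m Q = - g k.
Proof.
move=> Hf Hg ce ff fg.
have := coboundary_addb ce (row_free_noncoboundary (ltn0Sn n) Hf ff)
  (row_free_noncoboundary (ltn0Sn n) Hg fg).
move=> [d dE]; exists (sign_mx R d); split; first exact: sign_mx_orthogonal.
move=> k; have [ne fE] := Hf k; have [_ gE] := Hg k.
have inj2 := scalerI (sqrt2_neq0 R).
suff [E|E] : Num.sqrt 2 *: (f k *m sign_mx R d) = Num.sqrt 2 *: g k \/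
    Num.sqrt 2 *: (f k *m sign_mx R d) = - (Num.sqrt 2 *: g k).
- by left; apply: inj2.
- by right; apply: inj2; rewrite scalerN.
rewrite scalemxAl fE gE rootv_sign_mx rootvN; have := dE k.
by case: (s k); case: (t k); case: (s' k); case: (t' k); case: (d (e k).1);
  case: (d (e k).2) => //= _; auto.
Qed.

(** The vertex bijection acts as a coordinate permutation that makes the edges agree; after
    reordering and reorienting the edges of [g], only a change of coordinate signs remains. *)
Lemma mg_iso_isometric (R : realType) (n : nat)
    (f g : 'I_n.+1 -> 'rV[R]_n.+1) e s t e' s' t' :
  realizes f e s t -> realizes g e' s' t' -> econn e ->
  row_free (\matrix_i f i) -> row_free (\matrix_i g i) ->
  mg_iso (graph_of f) (graph_of g) -> isometric f g.
Proof.
move=> Hf Hg ce ff fg [p].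
pose h (x : 'I_n.+1 * 'I_n.+1) := upair (p x.1, p x.2).
have hU x : h (upair x) = h x.
  by case/upairP: (upair_id x) => ->; apply/upairP; auto.
rewrite graph_of_upair => pG.
have pE : perm_eq [seq h (e k) | k <- enum 'I_n.+1]
    [seq upair (e' k) | k <- enum 'I_n.+1].
  have /permPr <- := graph_of_perm Hg fg.
  apply: perm_trans pG; rewrite perm_sym.
  have := perm_map h (graph_of_perm Hf ff).
  by rewrite -map_comp (eq_map (g := fun k => h (e k))) // => k /=; rewrite hU.
have [r rE] := perm_eq_enum pE.
pose e1 k := (p (e k).1, p (e k).2).
have H1 : realizes (fun k => f k *m perm_mx p) e1 s t.
  apply: (realizes_orthogonal Hf) => k; last by rewrite rootv_perm_mx.
  by rewrite (inj_eq perm_inj); case: (Hf k).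
have [s2 [t2 H2]] : exists s2 t2, realizes (fun k => g (r k)) e1 s2 t2.
  apply: (realizes_reorient (e := fun k => e' (r k)) (s := fun k => s' (r k))
    (t := fun k => t' (r k))) => [k|k]; first exact: Hg.
  exact: rE.
have [||Q [oQ QE]] := same_edges_switching H1 H2 (econn_perm (p := p) ce).
- by rewrite row_free_orthogonal //; apply: perm_mx_orthogonal.
- by rewrite row_free_perm.
apply/isometricP => //; exists (perm_mx p *m Q), r; split.
  by apply: orthogonal_mul => //; apply: perm_mx_orthogonal.
by move=> k; rewrite mulmxA.
Qed.

Lemma edges_mg_iso (R : realType) (n : nat) (f g : 'I_n -> 'rV[R]_n)
    e s t e' s' t' (p r : {perm 'I_n}) :
  realizes f e s t -> realizes g e' s' t' ->
  row_free (\matrix_i f i) -> row_free (\matrix_i g i) ->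
  (forall k, upair (p (e k).1, p (e k).2) = upair (e' (r k))) ->
  mg_iso (graph_of f) (graph_of g).
Proof.
move=> Hf Hg ff fg pr; exists p; rewrite graph_of_upair.
pose h (x : 'I_n * 'I_n) := upair (p x.1, p x.2).
have hU x : h (upair x) = h x.
  by case/upairP: (upair_id x) => ->; apply/upairP; auto.
have /permPr -> := graph_of_perm Hg fg.
have /permPl -> := perm_map h (graph_of_perm Hf ff).
rewrite -map_comp (eq_map (g := (fun k => upair (e' k)) \o r)); last first.
  by move=> k /=; rewrite hU -pr.
rewrite map_comp perm_map //; apply: uniq_perm.
- by rewrite map_inj_uniq ?enum_uniq //; apply: perm_inj.
- exact: enum_uniq.
- move=> k; rewrite mem_enum; apply/mapP.
  by exists (r^-1%g k); rewrite ?mem_enum // permKV.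
Qed.

(** * Isometries in dimension greater than four, and the realization of graphs *)

Lemma Dn_root_int (R : realType) (n : nat) (v : 'rV[R]_n) k :
  Dn_root v -> v 0 k \is a Num.int.
Proof.
move=> /Dn_rootP[i [j [s [t [_ ->]]]]]; rewrite rootvE.
by rewrite rpredD // rpredM ?rpredX ?rpredN ?rpred1 // rpred_nat.
Qed.

(* Each column of Q lies in Z or in 1/2 + Z; being of norm 1 with more than four
   entries, it is integral. *)
Lemma root_isometry_signed_perm (R : realType) (n : nat) (Q : 'M[R]_n) :
  (4 < n)%N -> orthogonal_mx Q ->
  (forall v, Dn_root v -> Dn_root (v *m Q)) ->
  exists (p : {perm 'I_n}) (d : 'I_n -> bool),
    forall i, hb R i *m Q = (-1) ^+ d i *: hb R (p i).
Proof.
move=> n4 oQ rQ.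
have hQ i a : (hb R i *m Q) 0 a = Q i a by rewrite -rowE mxE.
have sumZ i j a : i != j -> Q i a + Q j a \is a Num.int.
  move=> ij; have : Dn_root (rootv R i j false false *m Q).
    by apply: rQ; apply/Dn_rootP; exists i, j, false, false.
  by move=> /(Dn_root_int a); rewrite mulmxDl !scale1r mxE !hQ.
have subZ i j a : i != j -> Q i a - Q j a \is a Num.int.
  move=> ij; have : Dn_root (rootv R i j false true *m Q).
    by apply: rQ; apply/Dn_rootP; exists i, j, false, true.
  by move=> /(Dn_root_int a); rewrite mulmxDl scale1r scaleN1r mulNmx mxE
    [X in _ + X]mxE !hQ.
have other i : exists j : 'I_n, i != j.
  have n0 : (0 < n)%N by lia. have n1 : (1 < n)%N by lia.
  case: (eqVneq i (Ordinal n0)) => [->|]; last by exists (Ordinal n0).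
  by exists (Ordinal n1).
have col a : \sum_i Q i a ^+ 2 = 1.
  have := congr1 (fun X : 'M_n => X a a) oQ.
  rewrite !mxE eqxx mulr1n => <-; apply: eq_bigr => i _.
  by rewrite mxE expr2.
have QZ i a : Q i a \is a Num.int.
  apply/negPn/negP => nZ.
  have nZ' j : Q j a \isn't a Num.int.
    have [<-//|ij] := eqVneq i j; apply: contra nZ => jZ.
    by rewrite -(subrK (Q j a) (Q i a)) rpredD // subZ.
  have ge j : 4^-1 <= Q j a ^+ 2.
    have [k jk] := other j.
    have Z2 : 2 * Q j a \is a Num.int.
      have -> : 2 * Q j a = (Q j a + Q k a) + (Q j a - Q k a) by ring.
      by rewrite rpredD ?sumZ ?subZ.
    have n0 : 2 * Q j a != 0.
      by rewrite mulf_neq0 ?pnatr_eq0 //; apply: contraNneq (nZ' j) => ->.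
    have := sqr_intr_ge1 Z2 n0; rewrite exprMn => ?; lra.
  have : \sum_(j < n) (4^-1 : R) <= 1.
    by rewrite -[X in _ <= X](col a); apply: ler_sum => j _; apply: ge.
  rewrite sumr_const card_ord -[X in X <= _]mulr_natl ler_pdivrMr ?ltr0n // mul1r.
  by rewrite ler_nat leqNgt n4.
have row i : \sum_a Q i a ^+ 2 = 1.
  have := congr1 (fun X : 'M_n => X i i) (mulmx1C oQ).
  rewrite !mxE eqxx mulr1n => <-; apply: eq_bigr => a _.
  by rewrite mxE expr2.
(* An integral row of norm 1 has a single nonzero entry, equal to 1 or -1. *)
have /fin_all_exists[h /fin_all_exists[d hE]] : forall i, exists (a : 'I_n) (b : bool),
    hb R i *m Q = (-1) ^+ b *: hb R a.
  move=> i; case: (pickP (fun a => Q i a != 0)) => [a ai|Q0]; last first.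
    have := row i; rewrite big1 => [/esym/eqP|a _]; first by rewrite oner_eq0.
    by have /negbFE/eqP -> := Q0 a; rewrite expr0n.
  have := row i; rewrite (bigD1 a) //= => rE.
  have rest0 : 0 <= \sum_(b | b != a) Q i b ^+ 2.
    by apply: sumr_ge0 => b _; apply: sqr_ge0.
  have Qa := sqr_intr_ge1 (QZ i a) ai.
  have Qa1 : Q i a ^+ 2 = 1 by lra.
  have /eqP : \sum_(b | b != a) Q i b ^+ 2 = 0 by lra.
  rewrite psumr_eq0 => [/allP Qb|b _]; last exact: sqr_ge0.
  exists a, (Q i a != 1); apply/rowP => b; rewrite hQ mxE hbE.
  have [->|ba] := eqVneq b a.
    rewrite mulr1; move/eqP: Qa1; rewrite sqrf_eq1 => /orP[]/eqP ->.
      by rewrite eqxx.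
    by case: eqP => // ?; lra.
  have := Qb b (mem_index_enum _); rewrite ba /= sqrf_eq0 => /eqP ->.
  by rewrite mulr0.
have hI : injective h.
  move=> i j hij; apply/eqP; apply/negPn/negP => ij.
  have := dotv_orthogonal (hb R i) (hb R j) oQ.
  rewrite !hE hij dotvZl dotvZr !dotv_hb !hbE eqxx mulr1 [j == i]eq_sym (negbTE ij).
  by move=> /eqP; rewrite mulf_eq0 !signr_eq0.
by exists (perm hI), d => i; rewrite hE permE.
Qed.

Lemma isometric_mg_iso_ge5 (R : realType) (n : nat) (f g : 'I_n -> 'rV[R]_n)
    e s t e' s' t' : (4 < n)%N ->
  realizes f e s t -> realizes g e' s' t' -> econn e ->
  row_free (\matrix_i f i) -> row_free (\matrix_i g i) ->
  isometric f g -> mg_iso (graph_of f) (graph_of g).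
Proof.
move=> n4 Hf Hg ce ff fg /(isometricP _ ff)[Q [r [oQ rE]]].
have n0 : (0 < n)%N by lia.
(* The reflection in [v *m Q] is the conjugate of a reflection generated by [f]. It thus lies in the
   group generated by [g], hence in W(D_n), whose reflections all come from roots. *)
have rQ v : Dn_root v -> Dn_root (v *m Q).
  move=> rv; apply: WD_reflP; first by rewrite dotv_orthogonal ?Dn_root_norm.
  apply: (refl_group_WD (f := g)); first by apply/in_DeltaP; exists e', s', t'.
  apply: (refl_groupS (f := fun k => f k *m Q)) => [k|].
    by case: (rE k) => ->; rewrite ?reflmxN; apply: refl_group_gen.
  apply/refl_group_conj => //; rewrite -reflmx_conj //.
  rewrite !mulmxA (mulmx1C oQ) mul1mx -mulmxA (mulmx1C oQ) mulmx1.
  by apply: realizes_full_group rv => //; eassumption.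
have [p [d pE]] := root_isometry_signed_perm n4 oQ rQ.
apply: (edges_mg_iso (p := p) (r := r) Hf Hg ff fg) => k.
have [ne fE] := Hf k; have [ne' gE] := Hg (r k).
have fQ : Num.sqrt 2 *: (f k *m Q) =
    rootv R (p (e k).1) (p (e k).2) (s k (+) d (e k).1) (t k (+) d (e k).2).
  by rewrite scalemxAl fE mulmxDl -!scalemxAl !pE !scalerA -!signr_addb.
apply/esym; case: (e' (r k)) ne' gE => i j /= ne' gE.
case: (rE k) => E; move: fQ; rewrite E ?scalerN gE ?rootvN; exact: rootv_relabel.
Qed.

Lemma graph_realization (R : realType) (n : nat) (G : mgraph n) :
  (0 < n)%N -> in_M G -> exists f : 'I_n -> 'rV[R]_n,
    [/\ is_family f, generates_Dn f, in_Delta f & mg_iso (graph_of f) G].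
Proof.
case: n G => // n G _ [lG cG uG].
have szG : size G = n.+1 by apply/(unicyclic_size (ltn0Sn n) lG cG).
have [e eG] : exists e : 'I_n.+1 -> 'I_n.+1 * 'I_n.+1,
    [seq e k | k <- enum 'I_n.+1] = G.
  exists (tnth (tcast szG (in_tuple G))).
  by rewrite map_tnth_enum val_tcast.
have ne k : (e k).1 != (e k).2.
  by apply: (allP lG); rewrite -eG map_f ?mem_enum.
have ce : econn e.
  move=> c cE; move/mg_connectedP: cG; apply=> x; rewrite -eG => /mapP[k _ ->].
  exact: cE.
have [x ncob] := noncoboundary_exists ce.
(* The negation makes the two signs agree exactly where [x] holds, so the sign pattern is the
   noncoboundary [x]. *)
pose f k : 'rV[R]_n.+1 := (Num.sqrt 2)^-1 *: rootv R (e k).1 (e k).2 false (~~ x k).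
have Hf : realizes f e (fun=> false) (fun k => ~~ x k).
  by move=> k; split=> //; rewrite scalerA mulfV ?scale1r ?sqrt2_neq0.
have nc : ~ coboundary e (fun k => false == ~~ x k).
  move=> [d dE]; apply: ncob; exists d => k.
  by rewrite -dE; case: (x k).
have fam := realizes_family Hf ce nc; have ff := fam.2.
exists f; split=> //.
- exact: realizes_generates_Dn Hf ce ff.
- by apply/in_DeltaP; exists e, (fun=> false), (fun k => ~~ x k).
- exists 1%g; rewrite -eG -map_comp.
  rewrite (eq_map (g := @upair n.+1)); last by move=> [a b]; rewrite !perm1.
  by rewrite graph_of_upair; apply: graph_of_perm Hf ff.
Qed.

(** * The four-dimensional case *)

Lemma uniq4E (T : eqType) (a b c d : T) : uniq [:: a; b; c; d] ->
  ((a == b) = false) * ((a == c) = false) * ((a == d) = false) *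
  ((b == c) = false) * ((b == d) = false) * ((c == d) = false) *
  ((b == a) = false) * ((c == a) = false) * ((d == a) = false) *
  ((c == b) = false) * ((d == b) = false) * ((d == c) = false).
Proof.
rewrite /= !inE !negb_or ![b == a]eq_sym ![c == a]eq_sym ![d == a]eq_sym.
rewrite ![c == b]eq_sym ![d == b]eq_sym ![d == c]eq_sym.
by case/and4P=> /and3P[/negbTE-> /negbTE-> /negbTE->] /andP[/negbTE-> /negbTE->]
  /negbTE->.
Qed.

Lemma mem4 (a b c d i : 'I_4) : uniq [:: a; b; c; d] -> i \in [:: a; b; c; d].
Proof.
move=> u; have := uniq_min_size u (s2 := enum 'I_4).
rewrite size_enum_ord; case=> // [x _|_ ->]; by rewrite mem_enum.
Qed.

Lemma upair_eqE (n : nat) (i j k l : 'I_n) : (upair (i, j) == upair (k, l)) =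
  (i == k) && (j == l) || (i == l) && (j == k).
Proof.
apply/eqP/orP; rewrite upairP.
  by case=> -[-> ->]; rewrite !eqxx; auto.
by case=> /andP[/eqP-> /eqP->]; auto.
Qed.

Lemma perm4 (a b c d a' b' c' d' : 'I_4) :
  uniq [:: a; b; c; d] -> uniq [:: a'; b'; c'; d'] ->
  exists p : {perm 'I_4}, [/\ p a = a', p b = b', p c = c' & p d = d'].
Proof.
move=> u u'.
pose h i := nth a' [:: a'; b'; c'; d'] (index i [:: a; b; c; d]).
have hI : injective h.
  move=> i j /eqP; rewrite nth_uniq ?index_mem ?mem4 // => /eqP.
  exact: index_inj (mem4 i u) (mem4 j u).
by exists (perm hI); rewrite !permE /h /= !eqxx !(uniq4E u).
Qed.

Lemma fresh4 (r : seq 'I_4) : (size r < 4)%N -> exists x, x \notin r.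
Proof.
move=> sr; case: (pickP (fun x => x \notin r)) => [x xr|all_r]; first by exists x.
have : (#|'I_4| <= #|r|)%N.
  by apply: subset_leq_card; apply/subsetP => x _; have /negbFE := all_r x.
by rewrite card_ord => /leq_trans/(_ (card_size r)); rewrite leqNgt sr.
Qed.

Lemma excluded_uniq (n : nat) (G : mgraph n) :
  excluded G -> uniq [seq upair x | x <- G].
Proof.
move=> [_ [a [b [c [d [u /= H]]]]]].
by case: H => /perm_uniq ->; rewrite /= !inE !upair_eqE !(uniq4E u) ?eqxx /=
  ?andbF ?orbF.
Qed.

(** Such a graph omits two of the six pairs: if these share a vertex it is a triangle with a pendant
    edge, if they are disjoint it is a 4-cycle. *)
Lemma uniq_graph4_excluded (G : mgraph 4) : loopless G -> size G = 4%N ->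
  uniq [seq upair x | x <- G] -> excluded G.
Proof.
move=> lG sG uG; split=> //.
pose i0 : 'I_4 := @Ordinal 4 0 isT; pose i1 : 'I_4 := @Ordinal 4 1 isT.
pose i2 : 'I_4 := @Ordinal 4 2 isT; pose i3 : 'I_4 := @Ordinal 4 3 isT.
pose G' := [seq upair x | x <- G].
pose L := [:: (i0, i1); (i0, i2); (i0, i3); (i1, i2); (i1, i3); (i2, i3)].
have GL x : x \in G' -> x \in L.
  move=> /mapP[y /(allP lG) ne ->]; case: y ne => -[i hi] [j hj].
  rewrite -val_eqE /=.
  by case: i hi => [|[|[|[|i]]]] hi //; case: j hj => [|[|[|[|j]]]] hj.
have GE : perm_eq G' (mask [seq x \in G' | x <- L] L).
  rewrite -filter_mask; apply: uniq_perm => //; first exact: filter_uniq.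
  by move=> x; rewrite mem_filter; case xG: (x \in G') => //=; rewrite GL.
(* Finite check: for each choice of four pairs out of [L], some ordering [q] of the vertices
   exhibits one of the two excluded shapes. *)
have : has (fun q : seq 'I_4 =>
    let a := nth i0 q 0 in let b := nth i0 q 1 in
    let c := nth i0 q 2 in let d := nth i0 q 3 in
    perm_eq (mask [seq x \in G' | x <- L] L)
      [seq upair e | e <- [:: (a, b); (b, c); (a, c); (c, d)]] ||
    perm_eq (mask [seq x \in G' | x <- L] L)
      [seq upair e | e <- [:: (a, b); (b, c); (c, d); (d, a)]])
    (permutations [:: i0; i1; i2; i3]).
  have := perm_size GE; rewrite size_map sG [map _ L]/=.
  do 6!case: (_ \in G'); by vm_compute.
case/hasP=> q; rewrite mem_permutations => qP /=.
have uq : uniq q by rewrite (perm_uniq qP).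
have := perm_size qP; case: q uq {qP} => [|a [|b [|c [|d [|? ?]]]]] // uq _.
by move=> /orP[] H; exists a, b, c, d; split=> //; [left | right];
  apply: perm_trans GE H.
Qed.

Lemma econn_cut (n m : nat) (e : 'I_m -> 'I_n * 'I_n) (c : 'I_n -> bool) i j :
  econn e -> c i != c j -> exists k, c (e k).1 != c (e k).2.
Proof.
move=> ce cij; case: (pickP (fun k => c (e k).1 != c (e k).2)) => [k ck|all_eq].
  by exists k.
by rewrite (ce c _ i j) ?eqxx // in cij => k; have /negbFE/eqP := all_eq k.
Qed.

Lemma double_edge_graph4 (e : 'I_4 -> 'I_4 * 'I_4) k0 k1 :
  (forall k, (e k).1 != (e k).2) -> econn e ->
  k0 != k1 -> upair (e k0) = upair (e k1) ->
  exists a b c d x, [/\ uniq [:: a; b; c; d], x \in [:: a; b; c] &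
    perm_eq [seq upair (e k) | k <- enum 'I_4]
      [seq upair y | y <- [:: (a, b); (a, b); (a, c); (x, d)]]].
Proof.
move=> ne ce k01 par.
have [y yab] : exists y, y \notin [:: (e k0).1; (e k0).2] by apply: fresh4.
(* By connectedness some edge leaves the double edge; the ends of the latter are then named so that
   this edge starts at [a]. *)
have [k2 cut2] : exists k2, ((e k2).1 \in [:: (e k0).1; (e k0).2]) !=
    ((e k2).2 \in [:: (e k0).1; (e k0).2]).
  apply: (econn_cut (c := fun v => v \in [:: (e k0).1; (e k0).2])
    (i := (e k0).1) (j := y)) => //.
  by rewrite (negbTE yab) mem_head.
have n2 k : upair (e k) = upair (e k0) -> k != k2.
  move=> /upairP kk0; apply: contraNneq cut2 => <-.
  by case: kk0 => -> /=; rewrite !inE !eqxx ?orbT.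
have [a [b [c [e0 [e2 [ab cab]]]]]] : exists a b c,
    upair (e k0) = upair (a, b) /\ upair (e k2) = upair (a, c) /\
    a != b /\ c \notin [:: a; b].
  have := ne k0; case: (e k0) cut2 => u v /= cut2 uv.
  have : exists a c, upair (e k2) = upair (a, c) /\ a \in [:: u; v] /\
      c \notin [:: u; v].
    case: (e k2) cut2 => w z /=; case w1: (w \in _); case z1: (z \in _) => //= _.
      by exists w, z; rewrite w1 z1.
    by exists z, w; rewrite w1 z1; split=> //; apply/upairP; right.
  move=> [a [c [e2 [+ cuv]]]]; rewrite !inE => /orP[]/eqP aE; subst a.
    by exists u, v, c.
  exists v, u, c; rewrite eq_sym; split; first by apply/upairP; right.
  by move: cuv; rewrite !inE orbC.
have [k3] : exists k3, k3 \notin [:: k0; k1; k2] by apply: fresh4.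
rewrite !inE !negb_or => /and3P[k30 k31 k32].
have uk : uniq [:: k0; k1; k2; k3].
  rewrite /= !inE !negb_or k01 (n2 k0) // (n2 k1) // ![_ == k3]eq_sym.
  by rewrite k30 k31 k32.
have [d dabc] : exists d, d \notin [:: a; b; c] by apply: fresh4.
have uabcd : uniq [:: a; b; c; d].
  move: cab dabc; rewrite /= !inE !negb_or ![_ == d]eq_sym ![_ == c]eq_sym ab.
  by move=> /andP[-> ->] /and3P[-> -> ->].
(* Some edge reaches the last vertex [d]; the first three avoid it, so it is [k3], and only its
   other end [x] is undetermined. *)
have [k4 cut4] : exists k4, ((e k4).1 == d) != ((e k4).2 == d).
  apply: (econn_cut (c := fun v => v == d) (i := a) (j := d)) => //.
  by rewrite eqxx (uniq4E uabcd).
have k43 : k4 = k3.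
  have := mem4 k4 uk; rewrite !inE => /or4P[] /eqP E //; move: cut4; rewrite E.
  - by case/upairP: e0 => -> /=; rewrite !(uniq4E uabcd).
  - by rewrite par in e0; case/upairP: e0 => -> /=; rewrite !(uniq4E uabcd).
  - by case/upairP: e2 => -> /=; rewrite !(uniq4E uabcd).
have [x [e3 xabc]] : exists x, upair (e k3) = upair (x, d) /\ x \in [:: a; b; c].
  have memx x : x != d -> x \in [:: a; b; c].
    by have := mem4 x uabcd; rewrite !inE => /or4P[]/eqP-> /negbTE E;
      rewrite ?eqxx ?orbT // eqxx in E *.
  move: cut4; rewrite k43; case: (e k3) => u v /=.
  case: (eqVneq u d) => [->|ud]; case: (eqVneq v d) => [->|vd] //= _.
    by exists v; split; [apply/upairP; right | apply: memx].
  by exists u; split=> //; apply: memx.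
exists a, b, c, d, x; split=> //.
have /(perm_map (fun k => upair (e k))) /permPl -> :
    perm_eq (enum 'I_4) [:: k0; k1; k2; k3].
  apply: uniq_perm; rewrite ?enum_uniq // => k.
  by rewrite mem_enum (mem4 k uk).
by rewrite /= -par e0 e2 e3.
Qed.

Section Dim4.
Variables (R : realType).
Implicit Types (f g : 'I_4 -> 'rV[R]_4) (e : 'I_4 -> 'I_4 * 'I_4).
Implicit Types (s t : 'I_4 -> bool).

Definition share1 (x y : 'I_4 * 'I_4) : bool :=
  ((x.1 == y.1) || (x.1 == y.2)) (+) ((x.2 == y.1) || (x.2 == y.2)).

(** Roots on disjoint pairs are orthogonal, one common vertex gives the product 1 or -1, and two
    independent roots on the same pair are of opposite types, hence orthogonal. *)
Lemma orth_share1 f e s t k l : realizes f e s t -> row_free (\matrix_i f i) ->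
  k != l -> (dotv (f k) (f l) == 0) = ~~ share1 (e k) (e l).
Proof.
move=> H ff kl; have [nk fk] := H k; have [nl fl] := H l.
have := realizes_parallel (k := k) (l := l) H.
have -> : (dotv (f k) (f l) == 0) =
    (dotv (rootv R (e k).1 (e k).2 (s k) (t k))
          (rootv R (e l).1 (e l).2 (s l) (t l)) == 0).
  by rewrite -fk -fl dotvZl dotvZr !mulf_eq0 (negbTE (sqrt2_neq0 R)).
rewrite dotv_rootv !rootvE /share1.
case: (e k) (e l) nk nl => i j [i' j'] /= nk nl par.
rewrite ![i == _]eq_sym ![j == _]eq_sym.
have distinct : upair (i, j) = upair (i', j') ->
    (s k == t k) = (s l == t l) -> False.
  move=> E st; case/negP: kl; apply/eqP; apply: (row_free_distinct ff).
  exact: par.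
have [ii|ii] := eqVneq i' i; have [ij|ij] := eqVneq i' j;
have [ji|ji] := eqVneq j' i; have [jj|jj] := eqVneq j' j; subst=> //=;
  try (by rewrite eqxx in nk); try (by rewrite eqxx in nl).
all: rewrite ?mulr0 ?addr0 ?add0r ?mulr1 ?mulr0 ?addr0 ?add0r ?eqxx //.
all: try by rewrite mulf_eq0 !signr_eq0.
- have {distinct} : (s k == t k) <> (s l == t l) by apply: distinct.
  by case: (s k); case: (t k); case: (s l); case: (t l) => //= _; apply/eqP; ring.
- have {distinct} : (s k == t k) <> (s l == t l) by apply/distinct/upairP; right.
  by case: (s k); case: (t k); case: (s l); case: (t l) => //= _; apply/eqP; ring.
Qed.

Definition orth_count f : nat :=
  (\sum_k \sum_l nat_of_bool (dotv (f k) (f l) == 0%R))%N.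

Lemma orth_count_perm f (p : {perm 'I_4}) :
  orth_count (fun k => f (p k)) = orth_count f.
Proof.
rewrite /orth_count [RHS](reindex_inj (h := p)) /=; last exact: perm_inj.
apply: eq_bigr => k _; rewrite [RHS](reindex_inj (h := p)) //; exact: perm_inj.
Qed.

Lemma orth_count_isometric f g : row_free (\matrix_i f i) ->
  isometric f g -> orth_count f = orth_count g.
Proof.
move=> ff /(isometricP _ ff)[Q [p [oQ pE]]]; rewrite -(orth_count_perm g p).
apply: eq_bigr => k _; apply: eq_bigr => l _; congr (nat_of_bool _).
rewrite -(dotv_orthogonal _ _ oQ).
by case: (pE k) => ->; case: (pE l) => ->; rewrite ?dotvNl ?dotvNr ?oppr_eq0.
Qed.

End Dim4.

Lemma isometric_perm (R : realType) (n : nat) (f : 'I_n -> 'rV[R]_n)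
    (p : {perm 'I_n}) (Q : 'M[R]_n) :
  orthogonal_mx Q -> isometric f (fun k => f (p k) *m Q).
Proof.
move=> oQ; exists Q; split=> // v; split=> -[k vE].
  by exists (p^-1%g k); rewrite permKV.
by exists (p k).
Qed.

Lemma realizes_tuple (R : realType) (n : nat) (f : 'I_n -> 'rV[R]_n) e s t
    (L : n.-tuple ('I_n * 'I_n)) :
  realizes f e s t -> row_free (\matrix_i f i) ->
  perm_eq [seq upair x | x <- graph_of f] [seq upair x | x <- L] ->
  exists (p : {perm 'I_n}) s' t', realizes (fun k => f (p k)) (tnth L) s' t'.
Proof.
move=> H ff; rewrite graph_of_upair => pL.
have pE : perm_eq [seq upair (tnth L k) | k <- enum 'I_n]
    [seq upair (e k) | k <- enum 'I_n].
  have -> : [seq upair (tnth L k) | k <- enum 'I_n] = [seq upair x | x <- L].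
    by rewrite (map_comp (@upair n)) map_tnth_enum.
  by rewrite perm_sym in pL; apply: perm_trans pL (graph_of_perm H ff).
have [p pP] := perm_eq_enum pE; exists p.
apply: (realizes_reorient (e := fun k => e (p k)) (s := fun k => s (p k))
  (t := fun k => t (p k))) => // k; exact: H.
Qed.

Definition parallel_graph4 (G : mgraph 4) (a b c d x : 'I_4) : Prop :=
  [/\ uniq [:: a; b; c; d], x \in [:: a; b; c] &
    perm_eq [seq upair y | y <- G]
      [seq upair y | y <- [:: (a, b); (a, b); (a, c); (x, d)]]].

Section Dim4Main.
Variables (R : realType).
Implicit Types (f g : 'I_4 -> 'rV[R]_4) (e : 'I_4 -> 'I_4 * 'I_4).
Implicit Types (s t : 'I_4 -> bool).

(** The double edge gives two ordered orthogonal pairs. The edge [xd] adds none if [x = a], one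
    disjoint edge [ac] if [x = b], and the two edges [ab] if [x = c]: the totals are 2, 4 and 6. *)
Lemma orth_count_parallel f e s t a b c d x :
  realizes f e s t -> row_free (\matrix_i f i) ->
  parallel_graph4 (graph_of f) a b c d x ->
  orth_count f = (index x [:: a; b; c]).*2.+2.
Proof.
move=> H ff [u xabc pL].
pose L := [tuple (a, b); (a, b); (a, c); (x, d)].
have [p [s' [t' H']]] := realizes_tuple (L := L) H ff pL.
have ff' : row_free (\matrix_i f (p i)) by rewrite row_free_perm.
rewrite -(orth_count_perm f p) /orth_count.
have E k l : nat_of_bool (dotv (f (p k)) (f (p l)) == 0) =
    ((k != l) && ~~ share1 (tnth L k) (tnth L l)) :> nat.
  case: (eqVneq k l) => [->|kl] /=.
    rewrite dotv_eq0; have [nl fl] := H' l.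
    by apply/eqP; rewrite eqb0; apply: contraNneq (rootv_neq0 R (s' l) (t' l) nl) => f0;
      rewrite -fl f0 scaler0.
  by rewrite -(orth_share1 H' ff' kl).
under eq_bigr => k _ do under eq_bigr => l _ do rewrite E.
rewrite !big_ord_recl !big_ord0 /share1 /=.
by move: xabc; rewrite !inE => /or3P[]/eqP ->;
  rewrite !(uniq4E u) ?eqxx /= ?(uniq4E u) ?eqxx.
Qed.

Lemma parallel_graph4_exists f e s t : realizes f e s t ->
  row_free (\matrix_i f i) -> econn e -> ~ excluded (graph_of f) ->
  exists a b c d x, parallel_graph4 (graph_of f) a b c d x.
Proof.
move=> H ff ce nex; have [lG cG uG] := graph_of_in_M (ltn0Sn 3) H ff ce.
have pG := graph_of_perm H ff.
have nu : ~~ uniq [seq upair (e k) | k <- enum 'I_4].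
  apply/negP => uE; apply: nex; apply: uniq_graph4_excluded => //.
    by apply/(unicyclic_size (ltn0Sn 3) lG cG).
  by rewrite graph_of_upair (perm_uniq pG).
have [k0 [k1 [k01 par]]] : exists k0 k1, k0 != k1 /\ upair (e k0) = upair (e k1).
  apply: contrapT => none; case/negP: nu; rewrite map_inj_uniq ?enum_uniq // => k l kl.
  by apply/eqP; apply/negPn/negP => nkl; apply: none; exists k, l.
have [k|a [b [c [d [x [u xabc pe]]]]]] := double_edge_graph4 _ ce k01 par.
  by case: (H k).
exists a, b, c, d, x; split=> //; rewrite graph_of_upair.
exact: perm_trans pG pe.
Qed.

Lemma isometric_mg_iso4 f g e s t e' s' t' :
  realizes f e s t -> realizes g e' s' t' -> econn e -> econn e' ->
  row_free (\matrix_i f i) -> row_free (\matrix_i g i) ->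
  ~ excluded (graph_of f) -> ~ excluded (graph_of g) ->
  isometric f g -> mg_iso (graph_of f) (graph_of g).
Proof.
move=> Hf Hg ce ce' ff fg nf ng fgI.
have [a [b [c [d [x Pf]]]]] := parallel_graph4_exists Hf ff ce nf.
have [a' [b' [c' [d' [x' Pg]]]]] := parallel_graph4_exists Hg fg ce' ng.
have := orth_count_isometric ff fgI.
rewrite (orth_count_parallel Hf ff Pf) (orth_count_parallel Hg fg Pg).
(* The count determines the position of [x] among [a], [b], [c], so matching the four labelled
   vertices matches all edges. *)
move=> /eqP; rewrite !eqSS => /eqP/double_inj xx'.
have [u xabc pf] := Pf; have [u' xabc' pg] := Pg.
have [p [pa pb pc pd]] := perm4 u u'.
have px : p x = x'.
  have lt : (index x [:: a; b; c] < size [:: a; b; c])%N by rewrite index_mem.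
  have := nth_map a a' p lt; rewrite (nth_index a xabc) => <-.
  by rewrite [map _ _]/= pa pb pc xx' (nth_index a' xabc').
exists p.
pose h (y : 'I_4 * 'I_4) := upair (p y.1, p y.2).
have hU y : h (upair y) = h y.
  by case/upairP: (upair_id y) => ->; apply/upairP; auto.
rewrite perm_sym; apply: perm_trans pg _; rewrite perm_sym.
have := perm_map h pf; rewrite -!map_comp /= !hU.
rewrite (eq_map (g := h)); last by move=> y /=; rewrite hU.
by rewrite /h /= pa pb pc pd px.
Qed.

(* For n = 4 the reflection in a half-sum vector (+-1/2, +-1/2, +-1/2, +-1/2)
   preserves the roots: it fixes those orthogonal to the vector and moves the
   others to the complementary pair of coordinates. *)
Lemma switch_to_parallel f e s t (a b c d : 'I_4) k0 k1 (dl : 'I_4 -> bool) :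
  uniq [:: a; b; c; d] -> realizes f e s t -> row_free (\matrix_i f i) ->
  k0 != k1 -> e k0 = (a, b) -> e k1 = (c, d) ->
  (forall k, k != k0 -> (s k == t k) = dl (e k).1 (+) dl (e k).2) ->
  exists Q e' s' t', [/\ orthogonal_mx Q,
    realizes (fun k => f k *m Q) e' s' t' & e' k0 = e' k1].
Proof.
move=> u H ff k01 e0 e1 dlE.
(* Twice the half-sum vector. By the condition on [dl] it is orthogonal to every normal except
   [f k0]. *)
pose w : 'rV[R]_4 := \row_i (-1) ^+ dl i.
have w4 : dotv w w = 4.
  rewrite dotvE (eq_bigr (fun=> 1)) ?sumr_const ?card_ord // => i _.
  by rewrite mxE -expr2 sqrr_sign.
have w0 : w != 0 by rewrite -dotv_eq0 w4 pnatr_eq0.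
have oW := reflmx_orthogonal w0.
have fix_f k : k != k0 -> f k *m reflmx w = f k.
  move=> kk0; rewrite mulmx_reflmx dotvC.
  suff /eqP -> : dotv w (f k) == 0 by rewrite mulr0 scale0r subr0.
  rewrite (realizes_dot _ _ H) !mxE; have := dlE k kk0.
  by case: (s k); case: (t k); case: (dl (e k).1); case: (dl (e k).2) => //= _;
    apply/eqP; rewrite ?expr0 ?expr1; ring.
(* Otherwise [dl] would present the whole sign pattern as a coboundary. So the root on [a], [b]
   agrees up to sign with [w] there, and the reflection leaves the opposite multiple of [w] on [c],
   [d]; this explains [q]. *)
have bad : s k0 (+) dl a = t k0 (+) dl b.
  have := row_free_noncoboundary (ltn0Sn 3) H ff.
  case: (eqVneq (s k0 (+) dl a) (t k0 (+) dl b)) => // ne []; exists dl => k.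
  have [->|kk0] := eqVneq k k0; last exact: dlE.
  by rewrite e0 /=; move: ne; case: (s k0); case: (t k0); case: (dl a); case: (dl b).
pose q := ~~ (s k0 (+) dl a).
have move_f : Num.sqrt 2 *: (f k0 *m reflmx w) = rootv R c d (q (+) dl c) (q (+) dl d).
  rewrite scalemxAl (H k0).2 e0 /= mulmx_reflmx w4 dotvC dotv_rootv.
  apply/rowP => i; rewrite mxE [X in _ + X]mxE [X in _ - X]mxE !rootvE !mxE /q.
  have := mem4 i u; rewrite !inE => /or4P[]/eqP ->; rewrite !(uniq4E u) !eqxx /=;
  by move: bad; case: (s k0); case: (t k0); case: (dl a); case: (dl b);
    case: (dl c); case: (dl d) => //= _; rewrite ?expr0 ?expr1; field.
exists (reflmx w), (fun k => if k == k0 then (c, d) else e k).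
exists (fun k => if k == k0 then q (+) dl c else s k).
exists (fun k => if k == k0 then q (+) dl d else t k); split.
- exact: oW.
- move=> k; case: (eqVneq k k0) => [->|kk0] /=.
    by rewrite (uniq4E u).
  by rewrite fix_f //; apply: H.
- by rewrite eqxx [k1 == k0]eq_sym (negbTE k01) e1.
Qed.

Lemma parallel_not_excluded f e s t k0 k1 : realizes f e s t ->
  row_free (\matrix_i f i) -> k0 != k1 -> e k0 = e k1 ->
  ~ excluded (graph_of f).
Proof.
move=> H ff k01 par /excluded_uniq; rewrite graph_of_upair.
rewrite (perm_uniq (graph_of_perm H ff)) => /injectiveP inj.
by case/negP: k01; apply/eqP; apply: inj; rewrite par.
Qed.

(* In both excluded graphs the edges other than ab form a spanning tree, so
   signs orthogonal to them exist; the edge ab is then moved onto cd. *)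
Lemma excluded_switch f e s t : realizes f e s t -> row_free (\matrix_i f i) ->
  excluded (graph_of f) ->
  exists (p : {perm 'I_4}) Q e' s' t', let g k := f (p k) *m Q in
    [/\ orthogonal_mx Q, realizes g e' s' t' & ~ excluded (graph_of g)].
Proof.
move=> H ff [_ [a [b [c [d [u G12]]]]]].
pose i0 : 'I_4 := @Ordinal 4 0 isT; pose i1 : 'I_4 := @Ordinal 4 1 isT.
pose i2 : 'I_4 := @Ordinal 4 2 isT; pose i3 : 'I_4 := @Ordinal 4 3 isT.
have ik k : k \in [:: i0; i1; i2; i3] by apply: mem4.
(* The list [L] starts with the edge [ab] to be moved, and [k1] is the position of [cd]. *)
have finish (L : 4.-tuple ('I_4 * 'I_4)) k1 :
    perm_eq [seq upair y | y <- graph_of f] [seq upair y | y <- L] ->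
    i0 != k1 -> tnth L i0 = (a, b) -> tnth L k1 = (c, d) ->
    (forall x : 'I_4 -> bool, exists dl : 'I_4 -> bool,
      forall k, k != i0 -> x k = dl (tnth L k).1 (+) dl (tnth L k).2) ->
    exists (p : {perm 'I_4}) Q e' s' t', let g k := f (p k) *m Q in
      [/\ orthogonal_mx Q, realizes g e' s' t' & ~ excluded (graph_of g)].
  move=> pL k01 L0 L1 tree.
  have [p [s' [t' H']]] := realizes_tuple H ff pL.
  have ff' : row_free (\matrix_i f (p i)) by rewrite row_free_perm.
  have [dl dlE] := tree (fun k => s' k == t' k).
  have [Q [e2 [s2 [t2 [oQ H2 par]]]]] :=
    switch_to_parallel u H' ff' k01 L0 L1 dlE.
  exists p, Q, e2, s2, t2; split=> //.
  by apply: (parallel_not_excluded H2 _ k01 par); rewrite row_free_orthogonal.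
case: G12 => pG.
  apply: (finish [tuple (a, b); (b, c); (a, c); (c, d)] i3) => // x.
  (* The value at [c] is set to [false], and the others are solved along the tree edges [bc], [ac],
     [cd]. *)
  exists (fun v => if v == b then x i1 else if v == a then x i2
                   else if v == d then x i3 else false) => k.
  have := ik k; rewrite !inE => /or4P[]/eqP -> // _;
  by rewrite (tnth_nth (a, a)) /= !eqxx !(uniq4E u) ?addbF.
apply: (finish [tuple (a, b); (b, c); (c, d); (d, a)] i2) => // x.
(* Again [c] gets [false]; the tree is now the path [bc], [cd], [da], so the value at [a]
   accumulates two edges. *)
exists (fun v => if v == b then x i1 else if v == d then x i2
                 else if v == a then x i2 (+) x i3 else false) => k.
have := ik k; rewrite !inE => /or4P[]/eqP -> // _;
by rewrite (tnth_nth (a, a)) /= ?eqxx !(uniq4E u) ?eqxx ?addbF ?addKb.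
Qed.

End Dim4Main.

(** * The correspondence *)

Lemma Delta_family_edges (R : realType) (n : nat) (f : 'I_n -> 'rV[R]_n) :
  (3 <= n)%N -> generates_Dn f -> in_Delta f ->
  exists e s t, realizes f e s t /\ econn e.
Proof.
move=> n3 gf /in_DeltaP[e [s [t H]]]; exists e, s, t; split=> //.
exact: generates_econn H gf.
Qed.

(** The isometry conjugating the group to W(D_n) turns each normal into one whose reflection lies in
    W(D_n); scaled to norm 2, it is a root by [WD_reflP]. *)
Lemma generating_family_Delta (R : realType) (n : nat) (f : 'I_n -> 'rV[R]_n) :
  is_family f -> generates_Dn f ->
  exists Q, orthogonal_mx Q /\ in_Delta (fun k => f k *m Q).
Proof.
move=> ff [Q [oQ QE]]; exists Q; split=> // k; apply: WD_reflP.
  by apply/sqrt2_norm; rewrite dotv_orthogonal //; apply: ff.1.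
rewrite reflmxZ ?sqrt2_neq0 // -reflmx_conj //.
by apply/QE; apply: refl_group_gen.
Qed.

Lemma Delta_family_not_excluded (R : realType) (n : nat) (g : 'I_n -> 'rV[R]_n) :
  is_family g -> in_Delta g ->
  exists (p : {perm 'I_n}) Q, [/\ orthogonal_mx Q,
    in_Delta (fun k => g (p k) *m Q) &
    ~ excluded (graph_of (fun k => g (p k) *m Q))].
Proof.
move=> fg gD; case: (pselect (excluded (graph_of g))) => [ex|nex]; last first.
  exists 1%g, 1%:M.
  have -> : (fun k => g ((1%g : {perm 'I_n}) k) *m 1%:M) = g.
    by apply/funext => k; rewrite perm1 mulmx1.
  by split=> //; apply: orthogonal1.
have [n4 _] := ex; subst n; have /in_DeltaP[e [s [t H]]] := gD.
have [p [Q [e' [s' [t' [oQ H' nex]]]]]] := excluded_switch H fg.2 ex.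
by exists p, Q; split=> //; apply/in_DeltaP; exists e', s', t'.
Qed.

Theorem theorem3 (R : realType) (n : nat) : (4 <= n)%N ->
  [/\ (* the graph of any realization in Delta(D_n) of a family generating D_n lies in M *)
      (forall f : 'I_n -> 'rV[R]_n,
         is_family f -> generates_Dn f -> in_Delta f -> in_M (graph_of f)),
      (* every family generating D_n is isometric to a realization in Delta(D_n)
         whose graph lies in M \ {Gamma_1, Gamma_2} *)
      (forall f : 'I_n -> 'rV[R]_n, is_family f -> generates_Dn f ->
         exists g, [/\ is_family g, in_Delta g, isometric f g,
                       in_M (graph_of g) & ~ excluded (graph_of g)]),
      (* families up to isometry <-> graphs up to isomorphism (injective, well defined) *)
      (forall f g : 'I_n -> 'rV[R]_n,
         is_family f -> generates_Dn f -> in_Delta f -> ~ excluded (graph_of f) ->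
         is_family g -> generates_Dn g -> in_Delta g -> ~ excluded (graph_of g) ->
         (isometric f g <-> mg_iso (graph_of f) (graph_of g))) &
      (* surjective onto M \ {Gamma_1, Gamma_2} *)
      (forall G : mgraph n, in_M G -> ~ excluded G ->
         exists f : 'I_n -> 'rV[R]_n,
           [/\ is_family f, generates_Dn f, in_Delta f & mg_iso (graph_of f) G])].
Proof.
case: n => // n n4; have n3 : (3 <= n.+1)%N by apply: ltnW.
have part1 (f : 'I_n.+1 -> 'rV[R]_n.+1) :
    is_family f -> generates_Dn f -> in_Delta f -> in_M (graph_of f).
  move=> ff gf fD; have [e [s [t [H ce]]]] := Delta_family_edges n3 gf fD.
  exact: graph_of_in_M H ff.2 ce.
split=> // [f ff gf|f g ff gf fD fn fg gg gD gn|G GM _].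
- have [Q [oQ fQD]] := generating_family_Delta ff gf.
  have fQ := family_orthogonal oQ ff.
  (* A second isometry removes an excluded graph; the permutation [p] only relists the normals and
     leaves the family unchanged. *)
  have [p [Q' [oQ' gD gn]]] := Delta_family_not_excluded fQ fQD.
  have E k : f (p k) *m Q *m Q' = f (p k) *m (Q *m Q') by rewrite mulmxA.
  have fg : isometric f (fun k => f (p k) *m Q *m Q').
    rewrite (funext E); apply: isometric_perm; exact: orthogonal_mul.
  have fam : is_family (fun k => f (p k) *m Q *m Q').
    apply: (family_orthogonal oQ'); split; first by move=> k; apply: fQ.1.
    by rewrite (row_free_perm (fun k => f k *m Q)); apply: fQ.2.
  exists (fun k => f (p k) *m Q *m Q'); split=> //.
  by apply: part1 => //; apply: isometric_generates gf.
- have [e [s [t [Hf ce]]]] := Delta_family_edges n3 gf fD.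
  have [e' [s' [t' [Hg ce']]]] := Delta_family_edges n3 gg gD.
  split; last exact: mg_iso_isometric Hf Hg ce ff.2 fg.2.
  have [n5|] := ltnP 4 n.+1; first exact: isometric_mg_iso_ge5 Hf Hg ce ff.2 fg.2.
  move=> n4'; have {n4 n4'} n3' : n = 3%N by lia.
  subst n; exact: isometric_mg_iso4 Hf Hg ce ce' ff.2 fg.2 fn gn.
- exact: graph_realization GM.
Qed.
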